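(* Let $\mathscr{O}$ be a discrete valuation ring with fraction field $\mathscr{K}$ and residue field $\mathbb{K}=\mathscr{O}/\mathfrak{m}$ of characteristic different from $2$, let $\mathrm{pr}:\mathscr{O}\to\mathbb{K}$ be the natural projection, and let $\mathcal{A}$ be an $\mathscr{O}$-superalgebra which is free of finite rank as an $\mathscr{O}$-module. Suppose $\mathcal{A}$ is (super)symmetric with a (super)symmetrizing form $t$, and that $\mathbb{K}\mathcal{A}=\mathbb{K}\otimes_{\mathscr{O}}\mathcal{A}$ and $\mathscr{K}\mathcal{A}=\mathscr{K}\otimes_{\mathscr{O}}\mathcal{A}$ are split. Then the following hold. (1) If $t$ is symmetric, then $\mathbb{K}\mathcal{A}$ is semisimple if and only if $\mathrm{pr}(s_V)\neq 0$ for every $V\in\mathrm{Irr}(\mathscr{K}\mathcal{A})$. (2) If $t$ is supersymmetric, then $\mathbb{K}\mathcal{A}$ is semisimple if and only if all simple modules of $\mathscr{K}\mathcal{A}$ are of type $\mathtt{M}$ and $\mathrm{pr}(s_V)\neq 0$ for every $V\in\mathrm{Irr}(\mathscr{K}\mathcal{A})$.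
   Context: A superalgebra is a $\mathbb{Z}_2$-graded associative algebra; modules over it are $\mathbb{Z}_2$-graded left modules, and a homogeneous homomorphism $f$ satisfies $f(av)=(-1)^{|f||a|}af(v)$ (homomorphisms are sums of homogeneous ones, so odd isomorphisms are allowed). A superalgebra over a field is semisimple if its ordinary (ungraded) Jacobson radical is $0$. $\mathrm{Irr}(-)$ is a complete set of pairwise non-isomorphic simple (graded, finite-dimensional) modules. A simple module is split if it remains simple after every field extension; a finite-dimensional superalgebra is split if all its simple modules are. For split superalgebras, a simple module $V$ is of type $\mathtt{M}$ (resp. $\mathtt{Q}$) if its (full, super) endomorphism algebra is one-dimensional (resp. two-dimensional). Forms. Let $\mathcal{A}$ be a superalgebra free of finite rank over a commutative domain $\mathrm{R}$. An $\mathrm{R}$-linear map $t:\mathcal{A}\to\mathrm{R}$ is non-degenerate if for some homogeneous basis $\mathcal{B}$ the matrix $(t(b_1b_2))_{b_1,b_2\in\mathcal{B}}$ has determinant in $\mathrm{R}^\times$; it is even if it vanishes on $\mathcal{A}_{\bar 1}$. A symmetrizing form is an even non-degenerate $t$ with $t(xy)=t(yx)$ for all $x,y$; a supersymmetrizing form is an even non-degenerate $t$ with $t(xy)=(-1)^{|x||y|}t(yx)$ for all homogeneous $x,y$. $\mathcal{A}$ is symmetric (supersymmetric) if it has such a form. ''(Super)symmetric'' means one of the two. The form $t$ extends by scalars to forms of the same kind on $\mathscr{K}\mathcal{A}$ and $\mathbb{K}\mathcal{A}$. Schur elements (with respect to the extension of $t$ to $\mathscr{K}\mathcal{A}$). Let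 $\mathcal{B}$ be a homogeneous basis with dual basis $\{b^\vee\}$, $t(b^\vee b')=\delta_{b,b'}$. For a module $V$ and even linear $f\in\mathrm{End}(V)_{\bar 0}$ put $I(f)(v)=\sum_{b}b^\vee f(bv)$ if $t$ is symmetric, and $I(f)(v)=\sum_b(-1)^{|b|}b^\vee f(bv)$ if $t$ is supersymmetric. If $t$ is symmetric and $V$ is split simple, $s_V$ is the unique scalar with $I(f)=s_V\,\mathrm{tr}(f)\,\mathrm{id}_V$ for all even $f$. If $t$ is supersymmetric and $V$ is split simple of type $\mathtt{M}$, $s_V$ is the unique scalar with $I(f)=s_V\,\mathrm{suptr}(f)\,\mathrm{id}_V$ for all even $f$, where $\mathrm{suptr}(f)=\mathrm{tr}(f|_{V_{\bar 0}})-\mathrm{tr}(f|_{V_{\bar 1}})$ (then $s_V$ depends on the isomorphism class of $V$ only up to sign). For $V\in\mathrm{Irr}(\mathscr{K}\mathcal{A})$ the Schur element $s_V$ lies in $\mathscr{O}$. *)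

(* Defs.v *)
From HB Require Import structures.
From mathcomp Require Import all_boot all_algebra.

Set Implicit Arguments.
Unset Strict Implicit.
Unset Printing Implicit Defensive.

Import GRing.Theory VectorInternalTheory.
Local Open Scope ring_scope.

(* Superspaces. A vectType over a ring R is a free R-module of finite rank.   *)
(* A decomposition V = V_0 (+) V_1 is given by the projection onto V_0 along  *)
(* V_1; parities are booleans, added with (+).                                *)

HB.mixin Record Vector_isSuper (R : nzRingType) V of Vector R V := {
  even_part : 'End(V);
  even_part_idem : (even_part \o even_part)%VF = even_part
}.

#[short(type="superVectType")]
HB.structure Definition SuperVect (R : nzRingType) :=
  {V of Vector R V & Vector_isSuper R V}.

Definition spart (R : nzRingType) (V : superVectType R) (p : bool) (v : V) : V :=
  if p then v - even_part v else even_part v.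

Definition homog (R : nzRingType) (V : superVectType R) (p : bool) (v : V) :=
  spart p v = v.

Definition hom_parity (R : nzRingType) (V W : superVectType R) (p : bool)
    (g : 'Hom(V, W)) :=
  forall q (v : V), homog q v -> homog (p (+) q) (g v).

Definition ltr (R : nzRingType) (V : vectType R) (g : 'End(V)) : R :=
  \tr (f2mx g).

Definition suptr (R : nzRingType) (V : superVectType R) (g : 'End(V)) : R :=
  ltr (g \o even_part)%VF - ltr (g \o (\1 - even_part))%VF.

Definition is_hbasis (R : nzRingType) (V : superVectType R) n
    (p : 'I_n -> bool) (B : 'I_n -> V) :=
  (forall i, homog (p i) (B i)) /\
  (forall v, exists! c : 'rV[R]_n, v = \sum_i c 0 i *: B i).

(* Superalgebras which are free of finite rank as modules. They are not       *)
(* required to be algTypes because these exclude the zero algebra.            *)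

Record superalgebra (R : comNzRingType) := Superalgebra {
  salg_space : superVectType R;
  salg_one : salg_space;
  salg_mul : salg_space -> salg_space -> salg_space;
  salg_mulA : associative salg_mul;
  salg_mul1r : left_id salg_one salg_mul;
  salg_mulr1 : right_id salg_one salg_mul;
  salg_mulDl : left_distributive salg_mul +%R;
  salg_mulDr : right_distributive salg_mul +%R;
  salg_scaleAl : forall a x y, a *: salg_mul x y = salg_mul (a *: x) y;
  salg_scaleAr : forall a x y, a *: salg_mul x y = salg_mul x (a *: y);
  salg_one_homog : homog false salg_one;
  salg_mul_homog : forall p q x y,
    homog p x -> homog q y -> homog (p (+) q) (salg_mul x y)
}.

Definition salg_sort (R : comNzRingType) (A : superalgebra R) : Type :=
  salg_space A.
Coercion salg_sort : superalgebra >-> Sortclass.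

Section SuperalgebraInstances.
Variables (R : comNzRingType) (A : superalgebra R).
HB.instance Definition _ := SuperVect.on (salg_sort A).
HB.instance Definition _ := GRing.Zmodule_isPzRing.Build (salg_sort A)
  (@salg_mulA R A) (@salg_mul1r R A) (@salg_mulr1 R A)
  (@salg_mulDl R A) (@salg_mulDr R A).

Lemma salgZAl a (x y : A) : a *: (x * y) = (a *: x) * y.
Proof. exact: salg_scaleAl. Qed.

Lemma salgZAr a (x y : A) : a *: (x * y) = x * (a *: y).
Proof. exact: salg_scaleAr. Qed.

Lemma salgM_homog p q (x y : A) :
  homog p x -> homog q y -> homog (p (+) q) (x * y).
Proof. exact: salg_mul_homog. Qed.

End SuperalgebraInstances.

Record supermodule (R : comNzRingType) (A : superalgebra R) := Supermodule {
  smod_space :> superVectType R;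
  smod_act : A -> 'End(smod_space);
  smod_act_linear : linear smod_act;
  smod_act1 : smod_act 1 = \1%VF;
  smod_actM : forall a b, smod_act (a * b) = (smod_act a \o smod_act b)%VF;
  smod_act_homog : forall p a, homog p a -> hom_parity p (smod_act a)
}.

(* Extension of scalars along a ring morphism f : R -> S. If V is free with   *)
(* basis (e_i), then S (x)_R V is realised as the row vectors over S, where   *)
(* the i-th coordinate is the coefficient of 1 (x) e_i; so ext_in f v stands  *)
(* for 1 (x) v and ext_hom f g for id (x) g. The type depends on f because    *)
(* the grading and the multiplication put on it do.                           *)

Definition std_basis (R : comNzRingType) (V : vectType R) (i : 'I_(dim V)) : V :=
  r2v (delta_mx 0 i).

Definition ext (R S : comNzRingType) (f : {rmorphism R -> S})
  (V : vectType R) : Type := 'rV[S]_(dim V).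

HB.instance Definition _ (R S : comNzRingType) (f : {rmorphism R -> S})
  (V : vectType R) := Vector.copy (ext f V) 'rV[S]_(dim V).

Section ExtSpace.
Variables (R S : comNzRingType) (f : {rmorphism R -> S}).

Definition ext_coord (V : vectType R) (i : 'I_(dim V)) (x : ext f V) : S :=
  (x : 'rV[S]_(dim V)) 0 i.

Definition ext_in (V : vectType R) (v : V) : ext f V := map_mx f (v2r v).

Definition ext_lin (V : vectType R) (W : lmodType S) (g : V -> W) (x : ext f V) :=
  \sum_i ext_coord i x *: g (std_basis i).

Definition ext_hom (V W : vectType R) (g : 'Hom(V, W)) :
    'Hom(ext f V, ext f W) :=
  linfun (ext_lin (fun v => ext_in (g v))).

Lemma ext_coord_linear (V : vectType R) i : scalar (@ext_coord V i).
Proof. by move=> a x y; rewrite /ext_coord !mxE. Qed.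

Lemma ext_lin_linear (V : vectType R) (W : lmodType S) (g : V -> W) :
  linear (ext_lin g).
Proof.
move=> a x y; rewrite /ext_lin scaler_sumr -big_split; apply: eq_bigr => i _.
by rewrite ext_coord_linear scalerDl scalerA.
Qed.

HB.instance Definition _ (V : vectType R) (W : lmodType S) (g : V -> W) :=
  GRing.isLinear.Build S (ext f V) W _ (ext_lin g) (ext_lin_linear g).

Lemma ext_in_linear (V : vectType R) (a : R) (u v : V) :
  ext_in (a *: u + v) = f a *: ext_in u + ext_in v.
Proof. by rewrite /ext_in linearP map_mxD map_mxZ. Qed.

Lemma ext_in0 (V : vectType R) : ext_in (0 : V) = 0.
Proof. by rewrite /ext_in linear0 map_mx0. Qed.

Lemma ext_inB (V : vectType R) (u v : V) : ext_in (u - v) = ext_in u - ext_in v.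
Proof. by rewrite /ext_in linearB map_mxB. Qed.

Lemma ext_coord_in (V : vectType R) i (v : V) :
  ext_coord i (ext_in v) = f (v2r v 0 i).
Proof. by rewrite /ext_coord mxE. Qed.

Lemma ext_decomp (V : vectType R) (x : ext f V) :
  x = \sum_i ext_coord i x *: ext_in (std_basis i).
Proof.
rewrite {1}[x](row_sum_delta (x : 'rV[S]_(dim V))).
by apply: eq_bigr => i _; rewrite /ext_in /std_basis r2vK map_delta_mx.
Qed.

Lemma ext_ind (V : vectType R) (P : ext f V -> Prop) :
  P 0 -> (forall a v x, P x -> P (a *: ext_in v + x)) -> forall x, P x.
Proof.
move=> P0 PD x; rewrite [x]ext_decomp.
by elim/big_rec: _ => // i y _; apply: PD.
Qed.

Lemma ext_lin_comb (V : vectType R) (W : lmodType S) (g h k : V -> W) a x :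
  (forall v, k v = a *: g v + h v) ->
  ext_lin k x = a *: ext_lin g x + ext_lin h x.
Proof.
move=> kE; rewrite /ext_lin scaler_sumr -big_split; apply: eq_bigr => i _.
by rewrite kE scalerDr !scalerA mulrC.
Qed.

Lemma ext_lin_in (V : vectType R) (W : lmodType S) (g : V -> W) :
  (forall a u v, g (a *: u + v) = f a *: g u + g v) ->
  forall v, ext_lin g (ext_in v) = g v.
Proof.
move=> gl v; have g0 : g 0 = 0.
  by have := gl (- 1) 0 0; rewrite scaler0 addr0 rmorphN1 scaleN1r addNr.
transitivity (g (\sum_i v2r v 0 i *: std_basis i)); last first.
  congr g; apply: v2r_inj; rewrite linear_sum [RHS](row_sum_delta (v2r v)).
  by apply: eq_bigr => i _; rewrite linearZ /= r2vK.
rewrite /ext_lin; symmetry.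
elim/big_rec2: _ => // i y w _ <-.
by rewrite gl ext_coord_in.
Qed.

Lemma ext_homE (V W : vectType R) (g : 'Hom(V, W)) v :
  ext_hom g (ext_in v) = ext_in (g v).
Proof.
rewrite lfunE /= ext_lin_in // => a u w.
by rewrite linearP ext_in_linear.
Qed.

Lemma ext_hom_eq (V W : vectType R) (g h : 'Hom(ext f V, ext f W)) :
  (forall v, g (ext_in v) = h (ext_in v)) -> g = h.
Proof.
move=> gh; apply/lfunP; apply: ext_ind => [|a v x IH]; first by rewrite !linear0.
by rewrite !linearD !linearZ /= gh IH.
Qed.

Lemma ext_hom_comp (U V W : vectType R) (g : 'Hom(V, W)) (h : 'Hom(U, V)) :
  ext_hom (g \o h)%VF = (ext_hom g \o ext_hom h)%VF.
Proof. by apply: ext_hom_eq => v; rewrite comp_lfunE !ext_homE comp_lfunE. Qed.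

Lemma ext_hom1 (V : vectType R) : ext_hom (\1%VF : 'End(V)) = \1%VF.
Proof. by apply: ext_hom_eq => v; rewrite ext_homE !id_lfunE. Qed.

Lemma ext_hom_linear (V W : vectType R) a (g h : 'Hom(V, W)) :
  ext_hom (a *: g + h) = f a *: ext_hom g + ext_hom h.
Proof.
apply: ext_hom_eq => v.
by rewrite add_lfunE scale_lfunE !ext_homE add_lfunE scale_lfunE ext_in_linear.
Qed.

End ExtSpace.

Lemma ext_even_part_idem (R S : comNzRingType) (f : {rmorphism R -> S})
    (V : superVectType R) :
  (ext_hom f (@even_part R V) \o ext_hom f (@even_part R V))%VF =
  ext_hom f (@even_part R V).
Proof. by rewrite -ext_hom_comp even_part_idem. Qed.

HB.instance Definition _ (R S : comNzRingType) (f : {rmorphism R -> S})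
    (V : superVectType R) :=
  Vector_isSuper.Build S (ext f V) (ext_even_part_idem f V).

Section Homogeneous.
Variables (R : nzRingType) (V : superVectType R).
Implicit Types (u v : V) (p : bool).

Lemma spart_linear p : linear (@spart R V p).
Proof.
move=> a u v; case: p; rewrite /spart linearP //.
by rewrite scalerBr opprD addrACA.
Qed.

Lemma spart_idem p v : spart p (spart p v) = spart p v.
Proof.
have e w : even_part (even_part w) = even_part w :> V.
  by rewrite -comp_lfunE even_part_idem.
case: p; rewrite /spart; last exact: e.
by rewrite raddfB /= e subrr subr0.
Qed.

HB.instance Definition _ p :=
  GRing.isLinear.Build R V V _ (@spart R V p) (spart_linear p).

Lemma homog0 p : homog p (0 : V).
Proof. exact: linear0. Qed.

Lemma homog_linear p a u v : homog p u -> homog p v -> homog p (a *: u + v).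
Proof. by rewrite /homog spart_linear => -> ->. Qed.

End Homogeneous.

Section ExtSuper.
Variables (R S : comNzRingType) (f : {rmorphism R -> S}).

Lemma ext_in_spart (V : superVectType R) p (v : V) :
  spart p (ext_in f v) = ext_in f (spart p v).
Proof. by case: p; rewrite /spart ?ext_inB [even_part _]ext_homE. Qed.

Lemma ext_in_homog (V : superVectType R) p (v : V) :
  homog p v -> homog p (ext_in f v).
Proof. by rewrite /homog ext_in_spart => ->. Qed.

Lemma ext_homog_ind (V : superVectType R) p (P : ext f V -> Prop) :
  P 0 -> (forall a v x, homog p v -> P x -> P (a *: ext_in f v + x)) ->
  forall x, homog p x -> P x.
Proof.
move=> P0 PD x <-; elim/ext_ind: x => [|a v x IH]; first by rewrite homog0.
by rewrite spart_linear ext_in_spart; apply: PD; first exact: spart_idem.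
Qed.

End ExtSuper.

Section ExtSuperalgebra.
Variables (R S : comNzRingType) (f : {rmorphism R -> S}) (A : superalgebra R).
Local Notation EA := (ext f A).

Definition ext_mul (x y : EA) : EA :=
  ext_lin (fun a : A => ext_lin (fun b : A => ext_in f (a * b)) y) x.

Lemma ext_mul_linearl a x x' y :
  ext_mul (a *: x + x') y = a *: ext_mul x y + ext_mul x' y.
Proof. by rewrite /ext_mul ext_lin_linear. Qed.

Lemma ext_mul_linearr a x y y' :
  ext_mul x (a *: y + y') = a *: ext_mul x y + ext_mul x y'.
Proof. by apply: ext_lin_comb => b; rewrite ext_lin_linear. Qed.

Lemma ext_mul_in (a b : A) : ext_mul (ext_in f a) (ext_in f b) = ext_in f (a * b).
Proof.
rewrite /ext_mul ext_lin_in => [|k u v].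
  rewrite ext_lin_in // => k u v.
  by rewrite -ext_in_linear mulrDr -salgZAr.
by apply: ext_lin_comb => c; rewrite -ext_in_linear mulrDl -salgZAl.
Qed.

Definition ext_one : EA := ext_in f (1 : A).

Lemma ext_mul0l x : ext_mul 0 x = 0.
Proof. by rewrite /ext_mul linear0. Qed.

Lemma ext_mul0r x : ext_mul x 0 = 0.
Proof. by have := ext_mul_linearr (-1) x 0 0; rewrite scaler0 addr0 scaleN1r addNr. Qed.

Lemma ext_mulA : associative ext_mul.
Proof.
move=> x y z; elim/ext_ind: x => [|a u x IHx]; first by rewrite !ext_mul0l.
rewrite !ext_mul_linearl IHx; congr (_ *: _ + _).
elim/ext_ind: y {IHx} => [|b v y IHy].
  by rewrite ext_mul0l ext_mul0r ext_mul0l.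
rewrite ext_mul_linearl !ext_mul_linearr ext_mul_linearl IHy; congr (_ *: _ + _).
elim/ext_ind: z {IHy} => [|c w z IHz]; first by rewrite !ext_mul0r.
by rewrite !ext_mul_linearr IHz !ext_mul_in mulrA.
Qed.

Lemma ext_mul1r : left_id ext_one ext_mul.
Proof.
elim/ext_ind=> [|a v x IH]; first by rewrite ext_mul0r.
by rewrite ext_mul_linearr IH ext_mul_in mul1r.
Qed.

Lemma ext_mulr1 : right_id ext_one ext_mul.
Proof.
elim/ext_ind=> [|a v x IH]; first by rewrite ext_mul0l.
by rewrite ext_mul_linearl IH ext_mul_in mulr1.
Qed.

Lemma ext_mulDl : left_distributive ext_mul +%R.
Proof. by move=> x y z; rewrite -[x]scale1r ext_mul_linearl !scale1r. Qed.

Lemma ext_mulDr : right_distributive ext_mul +%R.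
Proof. by move=> x y z; rewrite -[y]scale1r ext_mul_linearr !scale1r. Qed.

Lemma ext_scaleAl a x y : a *: ext_mul x y = ext_mul (a *: x) y.
Proof. by rewrite -[a *: x]addr0 ext_mul_linearl ext_mul0l addr0. Qed.

Lemma ext_scaleAr a x y : a *: ext_mul x y = ext_mul x (a *: y).
Proof. by rewrite -[a *: y]addr0 ext_mul_linearr ext_mul0r addr0. Qed.

Lemma ext_one_homog : homog false ext_one.
Proof. exact/ext_in_homog/salg_one_homog. Qed.

Lemma ext_mul_homog p q (x y : EA) :
  homog p x -> homog q y -> homog (p (+) q) (ext_mul x y).
Proof.
move=> hx; move: y; apply: ext_homog_ind => [|b v y hv IHy].
  by rewrite ext_mul0r; exact: homog0.
rewrite ext_mul_linearr; apply: homog_linear => //.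
move: x hx {IHy}; apply: ext_homog_ind => [|a u x hu IHx].
  by rewrite ext_mul0l; exact: homog0.
rewrite ext_mul_linearl; apply: homog_linear => //.
by rewrite ext_mul_in; apply/ext_in_homog/salgM_homog.
Qed.

Definition ext_salg : superalgebra S :=
  Superalgebra ext_mulA ext_mul1r ext_mulr1 ext_mulDl ext_mulDr
    ext_scaleAl ext_scaleAr ext_one_homog ext_mul_homog.

Definition ext_form (t : A -> R) (x : ext_salg) : S :=
  ext_lin (f := f) (W := S^o) (fun a : A => f (t a)) x.

Lemma ext_form_linear t : scalar (ext_form t).
Proof. by move=> a x y; apply: (ext_lin_linear (W := S^o)). Qed.

Lemma ext_form_in (t : {scalar A}) a : ext_form t (ext_in f (a : A)) = f (t a).
Proof. by apply: (ext_lin_in (W := S^o)) => k u v; rewrite linearP rmorphD rmorphM. Qed.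

Variable V : supermodule A.

Definition ext_act (x : ext_salg) : 'End(ext f V) :=
  ext_lin (f := f) (fun a : A => ext_hom f (smod_act V a)) x.

Lemma ext_act_linear : linear ext_act.
Proof. exact: ext_lin_linear. Qed.

Lemma ext_act_in (a : A) : ext_act (ext_in f a) = ext_hom f (smod_act V a).
Proof. by rewrite /ext_act ext_lin_in // => k u v; rewrite smod_act_linear ext_hom_linear. Qed.

Lemma ext_act0 : ext_act 0 = 0.
Proof. exact: linear0. Qed.

Lemma ext_act1 : ext_act 1 = \1%VF.
Proof. by rewrite ext_act_in smod_act1 ext_hom1. Qed.

Lemma ext_actM x y : ext_act (x * y) = (ext_act x \o ext_act y)%VF.
Proof.
elim/ext_ind: x => [|a u x IHx].
  by rewrite mul0r ext_act0 comp_lfun0l.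
rewrite mulrDl -salgZAl !ext_act_linear IHx comp_lfunDl -comp_lfunZl.
congr (_ *: _ + _); elim/ext_ind: y {IHx} => [|b v y IHy].
  by rewrite mulr0 ext_act0 comp_lfun0r.
rewrite mulrDr -salgZAr !ext_act_linear IHy comp_lfunDr -comp_lfunZr.
congr (_ *: _ + _); rewrite [_ * _]ext_mul_in !ext_act_in smod_actM.
exact: ext_hom_comp.
Qed.

Lemma ext_act_homog p (x : ext_salg) : homog p x -> hom_parity p (ext_act x).
Proof.
move=> hx q v; move: v; apply: ext_homog_ind => [|b v y hv IHy].
  by rewrite linear0; exact: homog0.
rewrite linearP /=; apply: homog_linear => //.
move: x hx {IHy}; apply: ext_homog_ind => [|a u x hu IHx].
  by rewrite ext_act0 zero_lfunE; exact: homog0.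
rewrite ext_act_linear add_lfunE scale_lfunE; apply: homog_linear => //.
rewrite ext_act_in ext_homE; apply: ext_in_homog.
exact: (smod_act_homog hu).
Qed.

Definition ext_smod : supermodule ext_salg :=
  Supermodule ext_act_linear ext_act1 ext_actM ext_act_homog.
End ExtSuperalgebra.

Definition is_dvr (O : idomainType) : Prop :=
  [/\ (forall I : O -> Prop,
         I 0 -> (forall x y, I x -> I y -> I (x + y)) ->
         (forall a x, I x -> I (a * x)) ->
         exists g, forall x, I x <-> exists a, x = a * g),
      (forall x y : O, x \isn't a GRing.unit -> y \isn't a GRing.unit ->
         x + y \isn't a GRing.unit)
    & exists2 x : O, x != 0 & x \isn't a GRing.unit].

(* For a local ring O, this says that pr induces an isomorphism between the   *)
(* residue field of O and k.                                                  *)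
Definition is_residue_map (O : idomainType) (k : fieldType)
    (pr : {rmorphism O -> k}) : Prop :=
  (forall y, exists x, pr x = y) /\
  (forall x, pr x = 0 <-> x \isn't a GRing.unit).

Section Radical.
Variables (R : comNzRingType) (A : superalgebra R).

Definition left_ideal (I : A -> Prop) : Prop :=
  [/\ I 0, forall x y, I x -> I y -> I (x + y) & forall a x, I x -> I (a * x)].

Definition maximal_left_ideal (I : A -> Prop) : Prop :=
  [/\ left_ideal I, ~ I 1 &
      forall J : A -> Prop, left_ideal J -> (forall x, I x -> J x) ->
        ~ J 1 -> forall x, J x -> I x].

Definition jacobson_radical (x : A) : Prop :=
  forall I, maximal_left_ideal I -> I x.

Definition semisimple_salg : Prop := forall x, jacobson_radical x -> x = 0.

End Radical.

Section Forms.
Variables (R : comUnitRingType) (A : superalgebra R) (t : A -> R).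

Definition even_form : Prop := forall x : A, homog true x -> t x = 0.

Definition nondegenerate_form : Prop :=
  exists n (p : 'I_n -> bool) (B : 'I_n -> A),
    is_hbasis p B /\ \det (\matrix_(i, j) t (B i * B j)) \is a GRing.unit.

Definition symmetrizing_form : Prop :=
  [/\ even_form, nondegenerate_form & forall x y : A, t (x * y) = t (y * x)].

Definition supersymmetrizing_form : Prop :=
  [/\ even_form, nondegenerate_form &
      forall p q (x y : A), homog p x -> homog q y ->
        t (x * y) = (-1) ^+ (p && q) * t (y * x)].

End Forms.

Section Simple.
Variables (K : fieldType) (A : superalgebra K).

Definition subsupermodule (V : supermodule A) (U : {vspace V}) : Prop :=
  (forall v, v \in U -> even_part v \in U) /\
  (forall (a : A) v, v \in U -> smod_act V a v \in U).

Definition simple_smod (V : supermodule A) : Prop :=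
  {: V}%VS != 0%VS /\
  forall U : {vspace V}, subsupermodule U -> U = 0%VS \/ U = {: V}%VS.

Definition homog_smod_end (V : supermodule A) (p : bool) (g : 'End(V)) : Prop :=
  hom_parity p g /\
  forall q (a : A) (v : V), homog q a ->
    g (smod_act V a v) = (-1) ^+ (p && q) *: smod_act V a (g v).

(* The full super endomorphism algebra: sums of an even and an odd one.       *)
Definition smod_end (V : supermodule A) (g : 'End(V)) : Prop :=
  exists g0 g1, [/\ g = g0 + g1, homog_smod_end false g0 & homog_smod_end true g1].

Definition type_M (V : supermodule A) : Prop :=
  exists E : {vspace 'End(V)}, (forall g, g \in E <-> smod_end g) /\ \dim E = 1%N.

End Simple.

Definition split_smod (K : fieldType) (A : superalgebra K)
    (V : supermodule A) : Prop :=
  forall (L : fieldType) (f : {rmorphism K -> L}), simple_smod (ext_smod f V).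

Definition split_salg (K : fieldType) (A : superalgebra K) : Prop :=
  forall V : supermodule A, simple_smod V -> split_smod V.

Section Schur.
Variables (K : fieldType) (A : superalgebra K) (t : A -> K) (V : supermodule A).

Definition is_dual_basis n (B Bd : 'I_n -> A) : Prop :=
  forall i j, t (Bd i * B j) = (i == j)%:R.

Definition casimir n (B Bd : 'I_n -> A) (g : 'End(V)) : 'End(V) :=
  \sum_i (smod_act V (Bd i) \o g \o smod_act V (B i))%VF.

Definition supercasimir n (p : 'I_n -> bool) (B Bd : 'I_n -> A) (g : 'End(V)) :
    'End(V) :=
  \sum_i (-1) ^+ p i *: (smod_act V (Bd i) \o g \o smod_act V (B i))%VF.

(* The operators casimir and supercasimir do not depend on the homogeneous    *)
(* basis; unique also rules out a vacuous reading of the inner quantifiers.   *)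
Definition schur_element (s : K) : Prop :=
  unique (fun s => forall n (p : 'I_n -> bool) (B Bd : 'I_n -> A) (g : 'End(V)),
    is_hbasis p B -> is_dual_basis B Bd -> hom_parity false g ->
    casimir B Bd g = (s * ltr g) *: \1%VF) s.

Definition super_schur_element (s : K) : Prop :=
  unique (fun s => forall n (p : 'I_n -> bool) (B Bd : 'I_n -> A) (g : 'End(V)),
    is_hbasis p B -> is_dual_basis B Bd -> hom_parity false g ->
    supercasimir p B Bd g = (s * suptr g) *: \1%VF) s.

End Schur.

(* Main.v *)
From HB Require Import structures.
Require Import Defs.
From mathcomp Require Import all_boot all_algebra all_field ring.
From Stdlib Require Import Classical.
Set Implicit Arguments.
Unset Strict Implicit.
Unset Printing Implicit Defensive.
Import GRing.Theory VectorInternalTheory.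
Local Open Scope ring_scope.

(** Both kinds of form are handled at once by a boolean [eps], false for a
symmetrizing and true for a supersymmetrizing form. As [t] vanishes on odd
elements, either symmetry says [t (x * y) = t (y * twist eps x)], where
[twist eps] multiplies odd elements by [(-1) ^+ eps]. On a module with a
homogeneous basis, let [rho] be the matrix representation, [T] the diagonal
matrix of the signs [(-1) ^+ eps] on odd vectors, and
[C G = \sum_b rho b^v *m G *m rho b] the Casimir operator. Replacing an
endomorphism [f] by [f T] absorbs the signs of the super case, both in the
Casimir operator and in the supertrace, so that in either case [s] is the Schur
element if and only if [C G = (s * \tr G) *: T] for all even [G]
([schur_eltP]). Whatever [G] is, [C G *m T] commutes with the algebra
([mx_casimir_comm]).

Two facts link the generic and the special fibre. The ring [O] is a valuation
ring, so every module over [KA] has a homogeneous basis on which [A] acts by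
matrices over [O] ([exists_lattice]); these can be reduced to the residue
field [k]. Dual bases of [A] remain dual over [K] and over [k].

Suppose that [kA] is semisimple and let [V] be simple over [KA]. The even
endomorphisms of [V] are scalars because [V] is split, which gives a Schur
element [s] in [K] ([mx_schur_exists]). Evaluating [C] at a diagonal matrix
unit of a lattice shows that [s] lies in [O], and modulo the maximal ideal the
identity [C G = (s * \tr G) *: T] holds for the reduced module. If the residue
of [s] were [0], then [C] would vanish there on all even matrices, and a matrix
coefficient would correspond under the form to a nonzero element of [kA]
generating a nilpotent left ideal ([casimir_nonzero]). In the super case an odd
endomorphism of [V] would anticommute with [T] and force [2 * s = 0]
([no_odd_commuting]), so [V] is of type M ([type_M_of_schur]).

Conversely, let all Schur elements have nonzero residue. For [V] simple the
element [z] dual to the (super)trace of [V] is central and acts on [V] by [s]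
or [2 * s] ([central_trace_element]), a unit of [O]; dividing by it gives a
central idempotent. Splitting off such idempotents until nothing is left
writes [t] over [K] as a combination of (super)traces of simple modules with
coefficients in [O]. Elements of [A] with even nilpotent residue have traces in
the maximal ideal, so the reduction of [t] vanishes on such residues
([form_expansion]). Therefore the form on [kA] vanishes on the Jacobson
radical, which is an ideal, and by nondegeneracy the radical is zero
([semisimple_of_schur]). *)

(** * Linear maps, gradings and Frobenius forms *)

Section LinearMaps.
Variables (R : pzRingType) (U W : lmodType R).

Lemma linear_at0 (f : U -> W) : linear f -> f 0 = 0.
Proof.
by move=> fl; have := fl (-1) 0 0; rewrite scaler0 addr0 scaleN1r => {1}->; rewrite addNr.
Qed.

Lemma linear_atZ (f : U -> W) : linear f -> forall a x, f (a *: x) = a *: f x.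
Proof. by move=> fl a x; have := fl a x 0; rewrite linear_at0 // !addr0. Qed.

Lemma linear_atD (f : U -> W) : linear f -> forall x y, f (x + y) = f x + f y.
Proof. by move=> fl x y; have := fl 1 x y; rewrite !scale1r. Qed.

Lemma linear_at_sum (f : U -> W) : linear f ->
  forall I (r : seq I) (Q : pred I) (c : I -> R) (F : I -> U),
  f (\sum_(i <- r | Q i) c i *: F i) = \sum_(i <- r | Q i) c i *: f (F i).
Proof.
move=> fl I r Q c F; elim/big_rec2: _ => [|i y x _ <-]; first exact: linear_at0.
exact: fl.
Qed.

End LinearMaps.

Lemma scalar_sum (R : pzRingType) (U : lmodType R) (t : U -> R) : scalar t ->
  forall I (r : seq I) (P : pred I) (c : I -> R) (F : I -> U),
  t (\sum_(i <- r | P i) c i *: F i) = \sum_(i <- r | P i) c i * t (F i).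
Proof.
move=> tl I r P c F.
have t0 : t 0 = 0.
  by have := tl (-1) 0 0; rewrite scaler0 add0r mulN1r addNr.
elim/big_rec2: _ => [|i y x _ <-]; first exact: t0.
exact: tl.
Qed.

Lemma scalarD_of (R : pzRingType) (U : lmodType R) (t : U -> R) : scalar t ->
  forall x y, t (x + y) = t x + t y.
Proof. by move=> tl x y; have := tl 1 x y; rewrite scale1r mul1r. Qed.

Lemma scalarZ_of (R : pzRingType) (U : lmodType R) (t : U -> R) : scalar t ->
  forall a x, t (a *: x) = a * t x.
Proof.
move=> tl a x; have := scalar_sum tl [:: tt] xpredT (fun _ => a) (fun _ => x).
by rewrite !big_seq1.
Qed.

Section Grading.
Variables (R : nzRingType) (V : superVectType R).
Implicit Types (v : V) (p : bool).

Lemma spartD v : v = spart false v + spart true v.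
Proof. by rewrite /spart addrC subrK. Qed.

Lemma spart_neg p v : spart p (spart (~~ p) v) = 0.
Proof.
have e w : even_part (even_part w) = even_part w :> V.
  by rewrite -comp_lfunE even_part_idem.
by case: p; rewrite /spart /= ?linearB /= e subrr.
Qed.

Lemma spart_homog p v : homog p (spart p v).
Proof. exact: spart_idem. Qed.

Lemma homog_other p v : homog p v -> spart (~~ p) v = 0.
Proof. by move=> <-; rewrite -{2}(negbK p) spart_neg. Qed.

Lemma homog_sum p I (r : seq I) (P : pred I) (F : I -> V) :
  (forall i, P i -> homog p (F i)) -> homog p (\sum_(i <- r | P i) F i).
Proof.
move=> h; elim/big_ind: _ => //; first exact: homog0.
by move=> x y hx hy; rewrite -[x]scale1r; apply: homog_linear.
Qed.

Lemma homogZ p a v : homog p v -> homog p (a *: v).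
Proof. by move=> h; rewrite -[_ *: _]addr0; apply: homog_linear (homog0 _ _). Qed.

Lemma homogB p u v : homog p u -> homog p v -> homog p (u - v).
Proof.
move=> hu hv; rewrite addrC -scaleN1r.
exact: homog_linear.
Qed.

Lemma homog_ind (P : V -> Prop) :
  (forall u v, P u -> P v -> P (u + v)) ->
  (forall p v, homog p v -> P v) -> forall v, P v.
Proof.
move=> PD Ph v; rewrite [v]spartD; apply: PD; apply: Ph; exact: spart_homog.
Qed.

End Grading.

Lemma salg_homog_ind (R : comNzRingType) (A : superalgebra R) (P : A -> Prop) :
  (forall x y, P x -> P y -> P (x + y)) ->
  (forall p x, homog p x -> P x) -> forall x, P x.
Proof. exact: homog_ind. Qed.

Section Twist.

Variables (R : comNzRingType) (A : superalgebra R) (eps : bool).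
Implicit Types (x y : A) (p : bool).

(** For [eps = true] this is the parity automorphism of the superalgebra. In
general it is the Nakayama automorphism of a (super)symmetrizing form, which
is why all later identities mention it instead of signs. *)
Definition twist x : A := spart false x + (-1) ^+ eps *: spart true x.

Lemma twist_linear : linear twist.
Proof.
move=> a x y; rewrite /twist !linearP /= !scalerDr !scalerA mulrC.
by rewrite addrACA.
Qed.

HB.instance Definition _ := GRing.isLinear.Build R A A _ twist twist_linear.

Lemma twistD x y : twist (x + y) = twist x + twist y.
Proof. exact: linearD. Qed.

Lemma twist0 : twist 0 = 0.
Proof. exact: linear0. Qed.

Lemma twistZ a x : twist (a *: x) = a *: twist x.
Proof. exact: linearZ. Qed.

Lemma twist_homog p x : homog p x -> twist x = (-1) ^+ (eps && p) *: x.
Proof.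
move=> h; rewrite /twist; case: p h => h; rewrite (homog_other h) h.
  by rewrite add0r andbT.
by rewrite scaler0 addr0 andbF scale1r.
Qed.

Lemma twist_even x : homog false x -> twist x = x.
Proof. by move=> h; rewrite (twist_homog h) andbF scale1r. Qed.

Lemma twistM x y : twist (x * y) = twist x * twist y.
Proof.
elim/salg_homog_ind: x => [x x' IHx IHx'|p x hx].
  by rewrite mulrDl !twistD mulrDl IHx IHx'.
elim/salg_homog_ind: y => [y y' IHy IHy'|q y hy].
  by rewrite mulrDr !twistD mulrDr IHy IHy'.
rewrite (twist_homog (salgM_homog hx hy)) (twist_homog hx) (twist_homog hy).
rewrite -salgZAl -salgZAr scalerA -signr_addb; congr (_ ^+ _ *: _).
by case: (eps) p q {hx hy} => [] [] [].
Qed.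

Lemma twistK : involutive twist.
Proof.
elim/salg_homog_ind => [x y IHx IHy|p x hx];
  first by rewrite (twistD x y) (twistD (twist x)) IHx IHy.
by rewrite (twist_homog hx) twistZ (twist_homog hx) scalerA -signr_addb addbb scale1r.
Qed.

End Twist.

Lemma std_basis_sum (R : comNzRingType) (V : vectType R) (v : V) :
  v = \sum_i v2r v 0 i *: std_basis i.
Proof.
apply: v2r_inj; rewrite linear_sum [LHS](row_sum_delta (v2r v)).
by apply: eq_bigr => i _; rewrite linearZ /= r2vK.
Qed.

Section Scalars.
Variables (R S : comNzRingType) (f : {rmorphism R -> S}) (A : superalgebra R).

Definition salg_in (a : A) : ext_salg f A := ext_in f a.

Lemma salg_in_linear c (a b : A) : salg_in (c *: a + b) = f c *: salg_in a + salg_in b.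
Proof. exact: ext_in_linear. Qed.

Lemma salg_in0 : salg_in 0 = 0.
Proof. exact: ext_in0. Qed.

Lemma salg_inM a b : salg_in (a * b) = salg_in a * salg_in b.
Proof. by rewrite [RHS]ext_mul_in. Qed.

Lemma salg_in1 : salg_in 1 = 1.
Proof. by []. Qed.

Lemma salg_in_homog p a : homog p a -> homog p (salg_in a).
Proof. exact: ext_in_homog. Qed.

Lemma salg_in_ind (P : ext_salg f A -> Prop) :
  P 0 -> (forall c a x, P x -> P (c *: salg_in a + x)) -> forall x, P x.
Proof. exact: ext_ind. Qed.

Lemma salg_in_sum n (c : 'I_n -> R) (F : 'I_n -> A) :
  salg_in (\sum_i c i *: F i) = \sum_i f (c i) *: salg_in (F i).
Proof.
elim/big_rec2: _ => [|i y x _ <-]; first exact: salg_in0.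
exact: salg_in_linear.
Qed.

Lemma form_in (t : {scalar A}) a : ext_form t (salg_in a) = f (t a).
Proof. exact: ext_form_in. Qed.

Lemma salg_in_surj : (forall y, exists x, f x = y) ->
  forall y, exists a, salg_in a = y.
Proof.
move=> surj; elim/salg_in_ind => [|c a x [b <-]]; first by exists 0; apply: salg_in0.
have [c' <-] := surj c; exists (c' *: a + b); exact: salg_in_linear.
Qed.

End Scalars.

(** A form together with a pair of dual bases. The two expansion properties encode
nondegeneracy in a way that passes to any extension of scalars. *)
Record frobenius_system (R : comNzRingType) (A : superalgebra R) (eps : bool)
    (t : A -> R) n (p : 'I_n -> bool) (B Bd : 'I_n -> A) : Prop := {
  frob_lin : scalar t;
  frob_even : forall x, homog true x -> t x = 0;
  frob_twist : forall x y, t (x * y) = t (y * twist eps x);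
  frob_homog : forall i, homog (p i) (B i);
  frob_dhomog : forall i, homog (p i) (Bd i);
  frob_dual : forall i j, t (Bd i * B j) = (i == j)%:R;
  frob_expand : forall y, y = \sum_i t (Bd i * y) *: B i;
  frob_dexpand : forall y, y = \sum_i t (y * B i) *: Bd i
}.

(** For homogeneous elements of different parity both sides vanish, as the form
is even; for equal parity [p && q] is just [p]. *)
Lemma frobenius_twist (R : comNzRingType) (A : superalgebra R) (t : {scalar A}) eps :
  (forall x, homog true x -> t x = 0) ->
  (forall p q (x y : A), homog p x -> homog q y ->
     t (x * y) = (-1) ^+ (eps && (p && q)) * t (y * x)) ->
  forall x y, t (x * y) = t (y * twist eps x).
Proof.
move=> te h x y; elim/salg_homog_ind: x => [x x' IHx IHx'|p x hx].
  by rewrite mulrDl twistD mulrDr !linearD IHx IHx'.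
elim/salg_homog_ind: y => [y y' IHy IHy'|q y hy].
  by rewrite mulrDr mulrDl !linearD IHy IHy'.
rewrite (twist_homog _ hx) -salgZAr linearZ /= (h _ _ _ _ hx hy).
have [->|neq] := eqVneq p q; first by rewrite andbb.
have -> : t (y * x) = 0; last by rewrite !mulr0.
by apply: te; have := salgM_homog hy hx; rewrite (_ : q (+) p) //;
  case: p q neq {hx hy h} => [] [].
Qed.

(** The dual basis is given by the inverse Gram matrix. It is homogeneous of the
same parities because the form pairs even elements only with even ones. *)
Lemma frobenius_systemP (R : comUnitRingType) (A : superalgebra R) (t : {scalar A}) eps :
  even_form t -> nondegenerate_form t ->
  (forall x y, t (x * y) = t (y * twist eps x)) ->
  exists n (p : 'I_n -> bool) (B Bd : 'I_n -> A),
    frobenius_system eps t p B Bd.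
Proof.
move=> te [n [p [B [[hB bB] Mu]]]] tt.
set M := \matrix_(i, j) _ in Mu.
have {}Mu : M \in unitmx by rewrite unitmxE.
pose Bd i := \sum_l invmx M i l *: B l.
have dual i j : t (Bd i * B j) = (i == j)%:R.
  rewrite /Bd mulr_suml linear_sum /=.
  have := congr1 (fun N : 'M_n => N i j) (mulVmx Mu); rewrite !mxE => <-.
  by apply: eq_bigr => l _; rewrite -salgZAl linearZ /= !mxE.
have ex y : y = \sum_i t (Bd i * y) *: B i.
  have [c [yE _]] := bB y; rewrite {1}yE; apply: eq_bigr => i _; congr (_ *: _).
  rewrite yE mulr_sumr linear_sum /= (bigD1 i) //= -salgZAr linearZ /= dual eqxx mulr1.
  rewrite big1 ?addr0 // => j ji.
  by rewrite -salgZAr linearZ /= dual eq_sym (negPf ji) mulr0.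
have dex y : y = \sum_i t (y * B i) *: Bd i.
  have BE l : B l = \sum_i t (B l * B i) *: Bd i.
    rewrite /Bd; under eq_bigr => i _ do rewrite scaler_sumr.
    rewrite exchange_big /=.
    under eq_bigr => i _ do under eq_bigr => j _ do rewrite scalerA.
    under eq_bigr => i _ do rewrite -scaler_suml.
    transitivity (\sum_i (M *m invmx M) l i *: B i).
      rewrite (mulmxV Mu) (bigD1 l) //= mxE eqxx scale1r big1 ?addr0 // => i il.
      by rewrite mxE eq_sym (negPf il) scale0r.
    apply: eq_bigr => i _; rewrite !mxE; congr (_ *: _).
    by apply: eq_bigr => j _; rewrite !mxE.
  have [c [yE _]] := bB y; rewrite {1}yE.
  under eq_bigr => i _ do rewrite (BE i) scaler_sumr.
  rewrite exchange_big /=; apply: eq_bigr => i _.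
  under eq_bigr => j _ do rewrite scalerA.
  rewrite -scaler_suml; congr (_ *: _); rewrite yE mulr_suml linear_sum /=.
  by apply: eq_bigr => j _; rewrite -salgZAl linearZ.
have hBd i : homog (p i) (Bd i).
  suff h0 : spart (~~ p i) (Bd i) = 0.
    rewrite /homog; move: (spartD (Bd i)).
    by case: (p i) h0 => /= ->; rewrite ?add0r ?addr0 => {2}->.
  rewrite [LHS]dex big1 // => j _.
  suff -> : t ((spart (~~ p i) (Bd i) : A) * B j) = 0 by rewrite scale0r.
  have odd0 q (x : A) : homog q x -> q != p j -> t (x * B j) = 0.
    move=> hx qj; apply: te; have := salgM_homog hx (hB j).
    by rewrite (_ : q (+) p j) //; case: q (p j) qj {hx} => [] [].
  have [e|ne] := eqVneq (~~ p i) (p j); last exact: odd0 (spart_homog _ _) ne.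
  have -> : spart (~~ p i) (Bd i) = Bd i - spart (p i) (Bd i).
    by rewrite {2}[Bd i]spartD; case: (p i); rewrite /= ?addrK // addrAC subrr add0r.
  have ij : i == j = false by apply/eqP=> ij; move: e; rewrite ij; case: (p j).
  rewrite mulrBl linearB /= dual ij (odd0 _ _ (spart_homog _ _)) ?subr0 //.
  by rewrite -e; case: (p i).
exists n, p, B, Bd; split=> //; by move=> a x y; rewrite linearP.
Qed.

Lemma frobenius_ext (R S : comNzRingType) (f : {rmorphism R -> S})
    (A : superalgebra R) (t : {scalar A}) eps n (p : 'I_n -> bool) (B Bd : 'I_n -> A) :
  frobenius_system eps t p B Bd ->
  frobenius_system eps (ext_form (f := f) t) p
    (fun i => salg_in f (B i)) (fun i => salg_in f (Bd i)).
Proof.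
case=> [tl te tt hB hBd dual ex dex].
have tfl := ext_form_linear (f := f) t.
have tfD := scalarD_of tfl; have tfZ := scalarZ_of tfl.
have tf0 : ext_form t (0 : ext_salg f A) = 0.
  by have := tfZ 0 0; rewrite scale0r mul0r.
have twin (x : A) : twist eps (salg_in f x) = salg_in f (twist eps x).
  elim/salg_homog_ind: x => [x y IHx IHy|q x hx].
    have inD (u v : A) : salg_in f (u + v) = salg_in f u + salg_in f v.
      by have := salg_in_linear f 1 u v; rewrite rmorph1 !scale1r.
    by rewrite (twistD _ x y) inD inD twistD IHx IHy.
  rewrite (twist_homog _ hx) (twist_homog _ (salg_in_homog f hx)).
  have := salg_in_linear f ((-1) ^+ (eps && q)) x 0.
  by rewrite !addr0 salg_in0 addr0 rmorph_sign.
split=> //.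
- move=> x; move: x; apply: (ext_homog_ind (f := f)) => [|c a x ha IH]; first exact: tf0.
  by rewrite tfl IH [ext_form _ _]form_in te // rmorph0 mulr0 addr0.
- move=> x y; elim/salg_in_ind: x => [|c a x IHx].
    by rewrite mul0r twist0 mulr0.
  rewrite mulrDl twistD twistZ mulrDr -salgZAl -salgZAr !tfD !tfZ IHx.
  congr (_ * _ + _); elim/salg_in_ind: y {IHx} => [|d b y IHy].
    by rewrite mulr0 mul0r.
  rewrite mulrDr mulrDl -salgZAl -salgZAr !tfD !tfZ IHy; congr (_ * _ + _).
  by rewrite twin -!salg_inM !form_in tt.
- by move=> i; apply: salg_in_homog.
- by move=> i; apply: salg_in_homog.
- by move=> i j; rewrite -salg_inM form_in dual rmorph_nat.
- elim/salg_in_ind => [|c a x IHx].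
    by rewrite big1 // => i _; rewrite mulr0 tf0 scale0r.
  rewrite {1}IHx {1}(ex a) salg_in_sum scaler_sumr -big_split /=.
  apply: eq_bigr => i _; rewrite mulrDr -salgZAr tfD tfZ -salg_inM form_in.
  by rewrite scalerDl scalerA.
- elim/salg_in_ind => [|c a x IHx].
    by rewrite big1 // => i _; rewrite mul0r tf0 scale0r.
  rewrite {1}IHx {1}(dex a) salg_in_sum scaler_sumr -big_split /=.
  apply: eq_bigr => i _; rewrite mulrDl -salgZAl tfD tfZ -salg_inM form_in.
  by rewrite scalerDl scalerA.
Qed.

Lemma frobenius_eq (R : comNzRingType) (A : superalgebra R) eps (t : A -> R) n
    (p : 'I_n -> bool) (B Bd : 'I_n -> A) : frobenius_system eps t p B Bd ->
  forall x y, (forall z, t (x * z) = t (y * z)) -> x = y.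
Proof.
move=> frob x y e; rewrite [x](frob_dexpand frob) [y](frob_dexpand frob).
by apply: eq_bigr => i _; rewrite e.
Qed.

(** * Graded matrix representations and the Casimir operator *)

Section MatrixParity.
Variables (R : comNzRingType) (d : nat) (q : 'I_d -> bool).
Implicit Types (G H : 'M[R]_d) (p : bool).

Definition mx_parity p G := forall i j, q i (+) q j != p -> G i j = 0.

Definition parity_mx (eps : bool) : 'M[R]_d :=
  diag_mx (\row_i (-1) ^+ (eps && q i)).

Lemma mul_parity_mx eps G i j :
  (parity_mx eps *m G) i j = (-1) ^+ (eps && q i) * G i j.
Proof. by rewrite mul_diag_mx !mxE. Qed.

Lemma mul_mx_parity eps G i j :
  (G *m parity_mx eps) i j = (-1) ^+ (eps && q j) * G i j.
Proof. by rewrite mul_mx_diag !mxE mulrC. Qed.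

Lemma parity_mxK eps : parity_mx eps *m parity_mx eps = 1%:M.
Proof.
by apply/matrixP=> i j; rewrite mul_parity_mx !mxE mulrnAr -signr_addb addbb.
Qed.

Lemma parity_mx_false : parity_mx false = 1%:M.
Proof. by apply/matrixP=> i j; rewrite !mxE. Qed.

Lemma parity_mxE eps i j : parity_mx eps i j = (-1) ^+ (eps && q i) *+ (i == j).
Proof. by rewrite !mxE. Qed.

Lemma mx_parityM p1 p2 G H :
  mx_parity p1 G -> mx_parity p2 H -> mx_parity (p1 (+) p2) (G *m H).
Proof.
move=> hG hH i j ij; rewrite mxE big1 // => l _.
have [e1|] := eqVneq (q i (+) q l) p1; last by move/hG->; rewrite mul0r.
have [e2|] := eqVneq (q l (+) q j) p2; last by move/hH->; rewrite mulr0.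
by move: ij; rewrite -e1 -e2 addbA -(addbA (q i)) addbb addbF eqxx.
Qed.

Lemma mx_parity_sum p I (r : seq I) (P : pred I) (F : I -> 'M_d) :
  (forall i, P i -> mx_parity p (F i)) -> mx_parity p (\sum_(i <- r | P i) F i).
Proof. by move=> h i j ij; rewrite summxE big1 // => l Pl; apply: h. Qed.

Lemma mx_parity_diag eps : mx_parity false (parity_mx eps).
Proof.
move=> i j; rewrite parity_mxE.
by have [->|ij _] := eqVneq i j; [rewrite addbb | rewrite mulr0n].
Qed.

Lemma mx_parity_delta i j : mx_parity (q i (+) q j) (delta_mx i j).
Proof.
move=> a b; rewrite mxE; have [->|//] := eqVneq a i; have [->|//] := eqVneq b j.
by rewrite eqxx.
Qed.

Lemma mx_parity_comm p eps G : mx_parity p G ->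
  parity_mx eps *m G *m parity_mx eps = (-1) ^+ (eps && p) *: G.
Proof.
move=> hG; apply/matrixP=> i j; rewrite mul_mx_parity mul_parity_mx !mxE mulrA -signr_addb.
have [<-|/hG->] := eqVneq (q i (+) q j) p; last by rewrite !mulr0.
by congr (_ ^+ _ * _); case: eps (q i) (q j) => [] [] [].
Qed.

End MatrixParity.

Lemma mulmx_delta_entry (R : comNzRingType) m n p r (H : 'M[R]_(p, m)) (K : 'M[R]_(n, r))
    (i : 'I_m) (j : 'I_n) a b :
  (H *m delta_mx i j *m K) a b = H a i * K j b.
Proof.
rewrite mxE (bigD1 j) //= big1 ?addr0 => [|l lj].
  rewrite mxE (bigD1 i) //= big1 ?addr0 => [|l li].
    by rewrite mxE !eqxx mulr1.
  by rewrite mxE (negPf li) mulr0.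
rewrite mxE big1 ?mul0r // => l' _.
by rewrite mxE (negPf lj) andbF mulr0.
Qed.

Record graded_mx_rep (R : comNzRingType) (A : superalgebra R) d
    (q : 'I_d -> bool) (rho : A -> 'M[R]_d) : Prop := {
  rep_linear : linear rho;
  rep1 : rho 1 = 1%:M;
  repM : forall x y, rho (x * y) = rho x *m rho y;
  rep_homog : forall p x, homog p x -> mx_parity q p (rho x)
}.

Section GradedRep.
Variables (R : comNzRingType) (A : superalgebra R) (d : nat) (q : 'I_d -> bool).
Variables (rho : A -> 'M[R]_d) (hrho : graded_mx_rep q rho).

Lemma rep0 : rho 0 = 0.
Proof. exact: linear_at0 (rep_linear hrho). Qed.

Lemma repD x y : rho (x + y) = rho x + rho y.
Proof. exact: linear_atD (rep_linear hrho) x y. Qed.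

Lemma repZ a x : rho (a *: x) = a *: rho x.
Proof. exact: linear_atZ (rep_linear hrho) a x. Qed.

Lemma repX x n : rho (x ^+ n) = iter n (mulmx (rho x)) 1%:M.
Proof. by elim: n => [|n IH]; rewrite ?(rep1 hrho) // exprS (repM hrho) IH. Qed.

Lemma rep_sum I (r : seq I) (P : pred I) (c : I -> R) (F : I -> A) :
  rho (\sum_(i <- r | P i) c i *: F i) = \sum_(i <- r | P i) c i *: rho (F i).
Proof. exact: linear_at_sum (rep_linear hrho) _ r P c F. Qed.

Lemma rep_twist eps x :
  rho (twist eps x) = parity_mx _ q eps *m rho x *m parity_mx _ q eps.
Proof.
elim/salg_homog_ind: x => [x y IHx IHy|p x hx].
  by rewrite (twistD _ x y) repD IHx IHy repD mulmxDr mulmxDl.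
by rewrite (twist_homog _ hx) repZ (mx_parity_comm _ (rep_homog hrho hx)).
Qed.

Lemma twist_commuting eps G :
  (forall a, G *m rho (twist eps a) = rho a *m G) ->
  forall a, rho a *m (G *m parity_mx R q eps) = G *m parity_mx R q eps *m rho a.
Proof.
move=> cG a; rewrite mulmxA -cG rep_twist -!mulmxA parity_mxK mulmx1.
by rewrite !mulmxA.
Qed.

Variables (eps : bool) (t : A -> R) (n : nat) (p : 'I_n -> bool) (B Bd : 'I_n -> A).
Hypothesis frob : frobenius_system eps t p B Bd.

Local Notation T := (parity_mx R q eps).

Definition mx_casimir (G : 'M[R]_d) : 'M[R]_d :=
  \sum_i rho (Bd i) *m G *m rho (B i).

Local Notation C := mx_casimir.

Lemma mx_casimir_linear : linear C.
Proof.
move=> a G H; rewrite /C scaler_sumr -big_split; apply: eq_bigr => i _ /=.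
by rewrite mulmxDr mulmxDl -scalemxAr -scalemxAl.
Qed.

HB.instance Definition _ := GRing.isLinear.Build R 'M[R]_d 'M[R]_d _ C mx_casimir_linear.

Lemma mx_casimir_entry j k a b :
  C (delta_mx j k) a b = \sum_i rho (Bd i) a j * rho (B i) k b.
Proof.
by rewrite /C summxE; apply: eq_bigr => i _; rewrite mulmx_delta_entry.
Qed.

(** Both sides expand to the double sum over [b, b'] of
[t (b^v * a * b') *: (rho b'^v *m G *m rho b)]: either [b^v * a] is expanded
in the dual basis, or [a * b'] in the basis. *)
Lemma mx_casimir_cycle a G : C (rho a *m G) = C (G *m rho a).
Proof.
transitivity (\sum_i \sum_j t (Bd i * a * B j) *: (rho (Bd j) *m G *m rho (B i))).
  apply: eq_bigr => i _.
  rewrite mulmxA -(repM hrho) {1}[Bd i * a](frob_dexpand frob) rep_sum.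
  rewrite !mulmx_suml; apply: eq_bigr => j _.
  by rewrite -!scalemxAl.
rewrite exchange_big; apply: eq_bigr => j _ /=.
rewrite -!mulmxA -(repM hrho) {1}[a * B j](frob_expand frob) rep_sum.
rewrite !mulmx_sumr; apply: eq_bigr => i _.
by rewrite -!scalemxAr !mulmxA mulrA.
Qed.

(** As for [mx_casimir_cycle], but moving [a] around the form costs a twist. *)
Lemma mx_casimir_twist a G : rho a *m C G = C G *m rho (twist eps a).
Proof.
transitivity (\sum_i \sum_j t (a * Bd i * B j) *: (rho (Bd j) *m G *m rho (B i))).
  rewrite mulmx_sumr; apply: eq_bigr => i _.
  rewrite !mulmxA -(repM hrho) {1}[a * Bd i](frob_dexpand frob) rep_sum.
  rewrite !mulmx_suml; apply: eq_bigr => j _.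
  by rewrite -!scalemxAl.
rewrite exchange_big mulmx_suml; apply: eq_bigr => j _ /=.
rewrite -!mulmxA -(repM hrho) {1}[B j * _](frob_expand frob) rep_sum.
rewrite !mulmx_sumr; apply: eq_bigr => i _.
rewrite -!scalemxAr !mulmxA; congr (_ *: _).
by rewrite -mulrA (frob_twist frob) mulrA.
Qed.

(** On the representation the twist is conjugation by [T], so multiplication by
[T] turns the twisted commutation into a genuine one. *)
Lemma mx_casimir_comm a G : rho a *m (C G *m T) = C G *m T *m rho a.
Proof. by apply: twist_commuting => b; rewrite mx_casimir_twist. Qed.

Lemma mx_casimir_parity r G : mx_parity q r G -> mx_parity q r (C G).
Proof.
move=> hG; apply: mx_parity_sum => i _.
have h1 := rep_homog hrho (frob_homog frob i).
have h2 := rep_homog hrho (frob_dhomog frob i).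
have := mx_parityM (mx_parityM h2 hG) h1.
by rewrite addbC addbA addbb addFb.
Qed.

Lemma mx_casimir_mulr G H : (forall a, rho a *m H = H *m rho a) ->
  C (G *m H) = C G *m H.
Proof.
move=> hH; rewrite /C mulmx_suml; apply: eq_bigr => i _.
by rewrite -!mulmxA hH.
Qed.

Lemma mx_casimir_mull G H : (forall a, rho a *m H = H *m rho a) ->
  C (H *m G) = H *m C G.
Proof.
move=> hH; rewrite /C mulmx_sumr; apply: eq_bigr => i _.
by rewrite !mulmxA hH.
Qed.

End GradedRep.

Lemma map_parity_mx (R S : comNzRingType) (f : {rmorphism R -> S}) d (q : 'I_d -> bool) eps :
  map_mx f (parity_mx R q eps) = parity_mx S q eps.
Proof. by apply/matrixP=> i j; rewrite !mxE rmorphMn rmorph_sign. Qed.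

Lemma map_mx_casimir (R S : comNzRingType) (f : {rmorphism R -> S}) (A : superalgebra R)
    (A' : superalgebra S) d (rho : A -> 'M[R]_d) (rho' : A' -> 'M[S]_d)
    (h : A -> A') n (B Bd : 'I_n -> A) G :
  (forall a, rho' (h a) = map_mx f (rho a)) ->
  mx_casimir rho' (fun i => h (B i)) (fun i => h (Bd i)) (map_mx f G) =
  map_mx f (mx_casimir rho B Bd G).
Proof.
move=> hh; rewrite /mx_casimir raddf_sum; apply: eq_bigr => i _.
by rewrite /= !hh !map_mxM.
Qed.

(** * The Jacobson radical of a finite-dimensional superalgebra *)

Section Jacobson.
Variables (F : fieldType) (A : superalgebra F).
Implicit Types (x y a : A).
Local Notation J := (@jacobson_radical F A).

Lemma left_idealZ (I : A -> Prop) : left_ideal I -> forall c x, I x -> I (c *: x).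
Proof. by case=> _ _ IM c x Ix; rewrite -[x]mul1r salgZAl; apply: IM. Qed.

Lemma left_ideal_principal (I : A -> Prop) x : left_ideal I ->
  left_ideal (fun y => exists i a, I i /\ y = i + a * x).
Proof.
case=> I0 ID IM; split.
- by exists 0, 0; rewrite mul0r addr0.
- move=> _ _ [i [a [Ii ->]]] [j [b [Ij ->]]]; exists (i + j), (a + b).
  by split; [apply: ID | rewrite mulrDl addrACA].
- move=> c _ [i [a [Ii ->]]]; exists (c * i), (c * a).
  by split; [apply: IM | rewrite mulrDr mulrA].
Qed.

(** If a maximal left ideal [I] missed [x], then [1 = i + a * x] with [i] in
[I]; but [1 - a * x] has a left inverse, a finite geometric series. *)
Lemma jacobson_of_nilpotent x : (forall a, exists n, (a * x) ^+ n = 0) -> J x.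
Proof.
move=> nil I maxI; have [lI I1 Imax] := maxI; have [I0 ID IM] := lI.
pose L y := exists i a, I i /\ y = i + a * x.
have lL : left_ideal L by exact: left_ideal_principal.
apply: (Imax L lL) => [y Iy||]; first by exists y, 0; rewrite mul0r addr0.
  case=> i [a [Ii e]]; have [n an] := nil a; apply: I1.
  have ei : i = 1 - a * x by rewrite e addrK.
  have -> : (1 : A) = (\sum_(k < n) (a * x) ^+ k) * i.
    rewrite ei; transitivity (1 - (a * x) ^+ n); first by rewrite an subr0.
    elim: n {an} => [|n IHn]; first by rewrite big_ord0 mul0r subrr.
    rewrite big_ord_recr mulrDl /= -IHn mulrBr mulr1 -exprSr.
    by rewrite addrA subrK.
  exact: IM.
by exists 0, 1; rewrite add0r mul1r.
Qed.

End Jacobson.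

Section JacobsonElements.
Variables (F : fieldType) (A : superalgebra F).
Implicit Types (x y a : A) (U : {vspace A}).
Local Notation J := (@jacobson_radical F A).

Lemma jacobson_left a x : J x -> J (a * x).
Proof. by move=> Jx I mI; have [[_ _ IM] _ _] := mI; apply: IM; apply: (Jx I). Qed.

Definition mulr_map (x y : A) : A := y * x.

Lemma mulr_map_linear x : linear (mulr_map x).
Proof. by move=> c y z; rewrite /mulr_map mulrDl salgZAl. Qed.

HB.instance Definition _ x :=
  GRing.isLinear.Build F A A _ (mulr_map x) (mulr_map_linear x).

Definition principal (x : A) : {vspace A} := limg (linfun (mulr_map x)).

Lemma principalP x y : reflect (exists a, y = a * x) (y \in principal x).
Proof.
apply: (iffP memv_imgP) => [[a _ ->]|[a ->]]; exists a; rewrite ?memvf ?lfunE //.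
Qed.

Definition stable U := forall a x, x \in U -> a * x \in U.

Lemma principal_stable x : stable (principal x).
Proof. by move=> a _ /principalP[b ->]; apply/principalP; exists (a * b); rewrite mulrA. Qed.

Lemma stable_left_ideal U : stable U -> left_ideal (fun x => x \in U).
Proof. by move=> sU; split=> //; [exact: mem0v | move=> x y; apply: memvD]. Qed.

Lemma stableD U V : stable U -> stable V -> stable (U + V)%VS.
Proof.
move=> sU sV a _ /memv_addP[u Uu [v Vv ->]].
by rewrite mulrDr memv_add ?sU ?sV.
Qed.

(** Left ideals are subspaces, so a proper one of maximal dimension exists. *)
Lemma exists_maximal_left_ideal U : stable U -> 1 \notin U ->
  exists I, @maximal_left_ideal F A I /\ forall x, x \in U -> I x.
Proof.
have [m] := ubnP (\dim {: A} - \dim U); elim: m U => // m IH U lem sU U1.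
have [[V [sV UV V1 nVU]]|nex] := classic (exists V : {vspace A},
    [/\ stable V, (U <= V)%VS, 1 \notin V & ~~ (V <= U)%VS]).
  have [|//|//|I [mI VI]] := IH V.
    rewrite -ltnS (leq_trans _ lem) // ltnS ltn_sub2l //.
      rewrite ltn_neqAle dimvS ?subvf // andbT.
      apply: contra U1 => /eqP e; have /eqP -> : U == {: A}%VS; last exact: memvf.
      by rewrite eqEdim subvf e leqnn.
    rewrite ltn_neqAle dimvS // andbT; apply: contra nVU => /eqP e.
    have /eqP <- : U == V; last by [].
    by rewrite eqEdim UV e leqnn.
  by exists I; split=> // x Ux; apply/VI/(subvP UV).
exists (fun x => x \in U); split=> //; split; first exact: stable_left_ideal.
  exact/negP.
move=> L [L0 LD LM] UL L1 x Lx; apply: NNPP => xU.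
apply: nex; exists (U + principal x)%VS; split.
- exact: (stableD sU (@principal_stable _)).
- exact: addvSl.
- apply/negP => /memv_addP[u Uu [_ /principalP[a ->] e]].
  by apply: L1; rewrite e; apply: LD; [apply: UL | apply: LM].
apply/negP => /subvP /(_ x) h; apply: xU; apply: h.
by apply: (subvP (addvSr U (principal x))); apply/principalP; exists 1; rewrite mul1r.
Qed.

Lemma jacobson_left_inverse x : J x -> exists c, c * (1 - x) = 1.
Proof.
move=> Jx; have [/principalP[c e]|n1] := boolP (1 \in principal (1 - x)).
  by exists c.
have [I [mI subI]] := exists_maximal_left_ideal (@principal_stable _) n1.
have [[_ ID _] I1 _] := mI; case: I1; rewrite -[1](subrK x).
apply: ID; last exact: (Jx I mI).
by apply: subI; apply/principalP; exists 1; rewrite mul1r.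
Qed.

(** The chain of left ideals [A x^n] becomes stationary, so
[x ^+ n = a * x ^+ n.+1] for some [n]; and [1 - a * x] has a left inverse. *)
Lemma jacobson_nilpotent x : J x -> exists n, x ^+ n = 0.
Proof.
move=> Jx; suff [//|h] : (exists n, x ^+ n = 0) \/
    forall n, (\dim (principal (x ^+ n)%R) + n <= \dim {: A})%N.
  have := h (\dim {: A}).+1.
  by rewrite addnS ltnNge leq_addl.
have [|nz] := classic (exists n, x ^+ n = 0); [by left | right].
elim=> [|n IH]; first by rewrite addn0 dimvS ?subvf.
apply: leq_trans IH; rewrite addnS ltn_add2r.
have sub : (principal (x ^+ n.+1)%R <= principal (x ^+ n)%R)%VS.
  by apply/subvP=> _ /principalP[a ->]; apply/principalP; exists (a * x); rewrite exprS mulrA.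
rewrite ltn_neqAle dimvS // andbT; apply/negP => /eqP e.
have /eqP E : principal (x ^+ n.+1)%R == principal (x ^+ n)%R by rewrite eqEdim sub e leqnn.
have : x ^+ n \in principal (x ^+ n)%R by apply/principalP; exists 1; rewrite mul1r.
rewrite -E => /principalP[a xn].
have [c ca] := jacobson_left_inverse (jacobson_left a Jx).
case: nz; exists n; rewrite -[LHS]mul1r -ca -mulrA mulrBl mul1r -mulrA -exprS -xn subrr.
by rewrite mulr0.
Qed.

Lemma maximal_left_ideal_twist eps I : @maximal_left_ideal F A I ->
  maximal_left_ideal (fun x => I (twist eps x)).
Proof.
have tw1 : twist eps (1 : A) = 1 by rewrite twist_even //; exact: salg_one_homog.
have tw L : @left_ideal F A L -> left_ideal (fun x => L (twist eps x)).
  case=> L0 LD LM; split; first by rewrite twist0.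
    by move=> x y Lx Ly; rewrite (twistD _ x y); apply: LD.
  by move=> a x Lx; rewrite twistM; apply: LM.
case=> lI I1 Imax; split; [exact: tw | by rewrite tw1 | ].
move=> L lL IL L1 x Lx; apply: (Imax (fun x => L (twist eps x))).
- exact: tw.
- by move=> y Iy; apply: IL; rewrite twistK.
- by rewrite tw1.
- by rewrite twistK.
Qed.

Lemma jacobson_twist eps x : J x -> J (twist eps x).
Proof. by move=> Jx I mI; apply: (Jx _ (maximal_left_ideal_twist eps mI)). Qed.

(** The parity automorphism permutes the maximal left ideals, so the radical is
graded as soon as [2] is invertible. *)
Lemma jacobson_spart x : 2%:R != 0 :> F -> J x -> J (spart false x).
Proof.
move=> two Jx; have -> : spart false x = 2%:R^-1 *: (x + twist true x) :> A.
  rewrite /twist {2}[x]spartD expr1 scaleN1r addrACA subrr addr0.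
  by rewrite -mulr2n -scaler_nat scalerA mulVf // scale1r.
move=> I mI; have [lI _ _] := mI; apply: left_idealZ => //.
by have [_ ID _] := lI; apply: ID; [apply: (Jx I) | apply: (jacobson_twist true Jx mI)].
Qed.

End JacobsonElements.

(** * Schur elements of matrix representations *)

(** If [N ^+ n = 0] then [det ('X - N)] divides [det ('X^n - N ^+ n)], a power
of ['X], so the characteristic polynomial is a power of ['X]. *)
Lemma mxtrace_nilpotent (F : fieldType) d (N : 'M[F]_d) n :
  iter n (mulmx N) 1%:M = 0 -> \tr N = 0.
Proof.
case: d N => [|d] N Nn; first by rewrite /mxtrace big_ord0.
have {}Nn : N ^+ n = 0.
  by rewrite -Nn; elim: n {Nn} => // n IH; rewrite exprS IH.
have dv : char_poly N %| ('X - 0%:P) ^+ (d.+1 * n).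
  (* Factor ['X ^+ n - N ^+ n] over the commuting matrices ['X] and [N]. *)
  pose M := map_mx polyC N;
    have cM : GRing.comm ('X%:M) M by rewrite /GRing.comm -!mulmxE scalar_mxC.
  have := subrXX_comm n cM.
  have -> : M ^+ n = 0 by rewrite /M -rmorphXn /= Nn map_mx0.
  rewrite subr0 -rmorphXn /= => /(congr1 determinant); rewrite det_scalar det_mulmx.
  rewrite subr0 mulnC exprM => ->; exact: dvdp_mulr.
have [k _ /eqpP] := dvdp_exp_XsubCP dv.
move=> [[a b] /= /andP[a0 b0] e].
have mon : char_poly N \is monic by exact: char_poly_monic.
have e' : char_poly N = 'X ^+ k.
  have ab : a = b.
    have := congr1 lead_coef e; rewrite !lead_coefZ (monicP mon) subr0.
    by rewrite lead_coefXn !mulr1.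
  by move: e; rewrite ab subr0 => /(scalerI b0).
have kd : k = d.+1 by have := size_char_poly N; rewrite e' size_polyXn => -[].
have := char_poly_trace N (ltn0Sn d); rewrite e' kd coefXn /= ltn_eqF // => /eqP.
by rewrite eq_sym oppr_eq0 => /eqP.
Qed.

Lemma mxtrace_delta_mul (R : comNzRingType) d (i j : 'I_d) (X : 'M[R]_d) :
  \tr (delta_mx i j *m X) = X j i.
Proof.
rewrite /mxtrace (bigD1 i) //= -[delta_mx i j]mul1mx mulmx_delta_entry mxE eqxx mul1r.
rewrite big1 ?addr0 // => l li.
by rewrite mulmx_delta_entry mxE (negPf li) mul0r.
Qed.

Lemma mxtrace_mul_delta (R : comNzRingType) d (i j : 'I_d) (X : 'M[R]_d) :
  \tr (X *m delta_mx i j) = X j i.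
Proof. by rewrite mxtrace_mulC mxtrace_delta_mul. Qed.

Lemma mxtrace_delta (R : comNzRingType) d (i j : 'I_d) :
  \tr (delta_mx i j : 'M[R]_d) = (i == j)%:R.
Proof. by rewrite -[delta_mx i j]mulmx1 mxtrace_delta_mul mxE eq_sym. Qed.

Section MatrixSchur.
Variables (F : fieldType) (A : superalgebra F) (d : nat) (q : 'I_d -> bool).
Variables (rho : A -> 'M[F]_d) (hrho : graded_mx_rep q rho).
Variables (eps : bool) (t : A -> F) (n : nat) (p : 'I_n -> bool) (B Bd : 'I_n -> A).
Hypothesis frob : frobenius_system eps t p B Bd.
Variable i0 : 'I_d.

Local Notation T := (parity_mx F q eps).
Local Notation C := (mx_casimir rho B Bd).
Local Notation commuting H := (forall a, rho a *m H = H *m rho a).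

(** The common form of both definitions of the Schur element; see [schur_eltP]. *)
Definition mx_schur (s : F) : Prop :=
  forall G, mx_parity q false G -> C G = (s * \tr G) *: T.

(** A diagonal entry of [C G *m T] is a linear functional of [G], hence equal to
[\tr (G *m z)] for some [z]. By [mx_casimir_cycle] this [z] commutes with the
algebra, and it is even as the functional vanishes on odd [G]; so [z] is a
scalar [s]. For even [G] the matrix [C G *m T] is itself a scalar. *)
Lemma mx_schur_exists :
  (forall H, mx_parity q false H -> commuting H -> exists c, H = c%:M) ->
  exists s, mx_schur s.
Proof.
move=> endo; pose phi G := (C G *m T) i0 i0.
have phil : scalar phi.
  move=> c G H; rewrite /phi.
  have -> : C (c *: G + H) = c *: C G + C H by exact: mx_casimir_linear.
  by rewrite mulmxDl -scalemxAl !mxE.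
pose z : 'M_d := \matrix_(k, j) phi (delta_mx j k).
have phiE G : phi G = \tr (G *m z).
  rewrite {1}[G]matrix_sum_delta pair_bigA (scalar_sum phil) /mxtrace.
  under [RHS]eq_bigr => i _ do rewrite mxE.
  by rewrite pair_bigA; apply: eq_bigr => -[i j] _; rewrite [z _ _]mxE.
have zcomm : commuting z.
  move=> a; apply/matrixP=> i j; rewrite -!mxtrace_delta_mul.
  transitivity (phi (delta_mx j i *m rho a)); first by rewrite phiE mulmxA.
  rewrite /phi -(mx_casimir_cycle hrho frob) -/(phi _) phiE.
  by rewrite mxtrace_mulC !mulmxA mxtrace_mulC mulmxA.
have zeven : mx_parity q false z.
  move=> i j ij; rewrite mxE /phi.
  have h := mx_casimir_parity hrho frob (@mx_parity_delta F d q j i).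
  have := mx_parityM h (@mx_parity_diag F d q eps).
  by apply; rewrite addbb; case: (q i) (q j) ij => [] [].
have [s zE] := endo z zeven zcomm.
exists s => G hG.
have [|a|c cE] := endo (C G *m T).
- exact: (mx_parityM (mx_casimir_parity hrho frob hG) (@mx_parity_diag F d q eps)).
- exact: (mx_casimir_comm hrho frob).
have cs : c = s * \tr G.
  have := phiE G; rewrite /phi cE zE mul_mx_scalar mxtraceZ => <-.
  by rewrite mxE eqxx.
rewrite -[C G]mulmx1 -(parity_mxK F q eps) mulmxA cE cs.
by rewrite mul_scalar_mx.
Qed.

(** Otherwise let [x] represent the matrix coefficient at [(i0, i0)] through the
form, so that [t (x * y) = rho y i0 i0]. Vanishing of [C] says that the rows of
[rho x] of the parity of [i0] are zero, which makes [x * a * x] orthogonal to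
everything for [a] even. Then [x * a * x * b * x = 0] for all [a] and [b]:
only their odd parts matter, and [a * x * b] is even when both are odd. So [x]
lies in the radical, although [t x = 1]. *)
Lemma casimir_nonzero : semisimple_salg A ->
  exists j k, q j = q k /\ C (delta_mx j k) <> 0.
Proof.
move=> ss; apply: NNPP => nex.
have C0 j k : q j = q k -> C (delta_mx j k) = 0.
  by move=> jk; apply: NNPP => h; apply: nex; exists j, k.
have tl := frob_lin frob.
pose x : A := \sum_i rho (B i) i0 i0 *: Bd i.
have xeven : homog false x.
  apply: homog_sum => i _.
  have := frob_dhomog frob i; have := rep_homog hrho (frob_homog frob i).
  case: (p i) => h hd; last exact: homogZ.
  by rewrite (h i0 i0) ?addbb // scale0r; exact: homog0.
have tx y : t (x * y) = rho y i0 i0.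
  rewrite {2}[y](frob_expand frob) (rep_sum hrho) summxE /x mulr_suml.
  under eq_bigr => i _ do rewrite -salgZAl.
  rewrite (scalar_sum tl); apply: eq_bigr => i _.
  by rewrite mxE mulrC.
have xrow k l : q k = q i0 -> rho x k l = 0.
  move=> qk; have [ql|ql] := eqVneq (q l) (q i0); last first.
    by apply: (rep_homog hrho xeven); rewrite qk; case: (q i0) (q l) ql => [] [].
  transitivity (C (delta_mx l i0) k i0); last by rewrite (C0 _ _ ql) mxE.
  rewrite mx_casimir_entry (rep_sum hrho) summxE; apply: eq_bigr => i _.
  by rewrite mxE mulrC.
(* [x * a * x] is orthogonal to everything: only the rows of [rho x] of
   the parity of [i0] enter, since [a] is even. *)
have xax a : homog false a -> x * a * x = 0.
  move=> ha; rewrite [LHS](frob_dexpand frob) big1 // => i _.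
  rewrite -!mulrA tx !(repM hrho) mxE big1 ?scale0r // => k _.
  have [qk|qk] := eqVneq (q k) (q i0); last first.
    by rewrite (rep_homog hrho ha) ?mul0r //; case: (q i0) (q k) qk => [] [].
  by rewrite mxE big1 ?mulr0 // => l _; rewrite xrow // mul0r.
have xodd a : x * a * x = x * (spart true a : A) * x.
  rewrite {1}[a]spartD mulrDr mulrDl (xax (spart false a)) ?add0r //.
  exact: spart_homog.
have x5 a b : x * a * x * b * x = 0.
  rewrite xodd -mulrA -(mulrA (x * _)) (mulrA x b x) xodd.
  rewrite !mulrA -(mulrA x) -(mulrA x) xax // -[false]/(true (+) false (+) true).
  by apply: salgM_homog; [apply: salgM_homog|]; rewrite ?xeven //; apply: spart_homog.
have x0 : x = 0.
  apply: ss; apply: jacobson_of_nilpotent => a; exists 3%N.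
  by rewrite !exprS expr0 mulr1 -(mulr0 a) -(x5 a a) !mulrA.
have := tx 1; rewrite x0 mul0r (rep1 hrho) mxE eqxx => /esym e.
have := scalarZ_of tl 0 0; rewrite scale0r mul0r -e => /eqP.
by rewrite oner_eq0.
Qed.

Hypothesis two : 2%:R != 0 :> F.

Lemma eq_opp0 (x : F) : x = - x -> x = 0.
Proof.
move=> e; apply/eqP; have /eqP : 2%:R * x = 0 by rewrite mulr_natl mulr2n {1}e addNr.
by rewrite mulf_eq0 (negPf two).
Qed.

Lemma mx_parity_inv (H : 'M[F]_d) : H \in unitmx -> mx_parity q true H ->
  mx_parity q true (invmx H).
Proof.
move=> uH hH i j; have P2 := parity_mxK F q true.
set P := parity_mx _ _ _ in P2.
have PHP : P *m H *m P = - H.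
  by rewrite (mx_parity_comm _ hH) expr1 scaleN1r.
have PVP : P *m invmx H *m P = - invmx H.
  have e : P *m invmx H *m P *m H = - 1%:M.
    rewrite -{2}[H]opprK -PHP mulmxN; congr (- _).
    by rewrite !mulmxA -(mulmxA _ P P) P2 mulmx1 -(mulmxA P) mulVmx // mulmx1.
  by rewrite -[LHS]mulmx1 -(mulmxV uH) mulmxA e mulNmx mul1mx.
case ij: (q i (+) q j) => // _; apply: eq_opp0.
have := congr1 (fun M : 'M_d => M i j) PVP.
rewrite mul_mx_parity mul_parity_mx mulrA -signr_addb !mxE.
by rewrite addbC ij mul1r.
Qed.

Lemma commuting_inv (H : 'M[F]_d) : H \in unitmx -> commuting H -> commuting (invmx H).
Proof.
move=> uH cH a; rewrite -[LHS]mul1mx -{1}(mulVmx uH) -!mulmxA; congr (_ *m _).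
by rewrite !mulmxA -cH -mulmxA mulmxV // mulmx1.
Qed.

(** Conjugating [G] by an invertible odd [H] in the commutant does not change
[\tr G], but changes [C G = (s * \tr G) *: T] by conjugation of [T], that is,
by a sign. *)
Lemma no_odd_commuting s (H : 'M[F]_d) : eps = true -> s != 0 -> mx_schur s ->
  mx_parity q true H -> commuting H -> H \notin unitmx.
Proof.
move=> e s0 sch hH cH; apply/negP => uH.
pose G : 'M[F]_d := delta_mx i0 i0.
have hG : mx_parity q false G by have := @mx_parity_delta F d q i0 i0; rewrite addbb.
have := sch (H *m G *m invmx H).
have -> : \tr (H *m G *m invmx H) = 1.
  by rewrite mxtrace_mulC mulmxA mulVmx // mul1mx mxtrace_delta eqxx.
have hV := mx_parity_inv uH hH.
have par : mx_parity q false (H *m G *m invmx H).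
  exact: (mx_parityM (mx_parityM hH hG) hV).
move=> /(_ par); rewrite (mx_casimir_mulr _ _ _ (commuting_inv uH cH)).
rewrite (mx_casimir_mull _ _ _ cH) (sch G hG) mxtrace_delta eqxx mulr1.
rewrite -scalemxAr -scalemxAl => /(congr1 (fun M => s^-1 *: M *m H)).
rewrite !scalerA mulVf // !scale1r -mulmxA mulVmx // mulmx1 => HT.
have := mx_parity_comm eps hH; rewrite e /= expr1 scaleN1r -e -HT -mulmxA parity_mxK mulmx1.
move=> HN; have H0 : H = 0.
  by apply/matrixP=> i j; rewrite [RHS]mxE; apply: eq_opp0; rewrite {1}HN mxE.
have := congr1 (fun M : 'M_d => M i0 i0) (mulmxV uH).
by rewrite H0 mul0mx !mxE eqxx => /esym/eqP; rewrite oner_eq0.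
Qed.

(** The element [z] is dual to the (super)trace, and is central because
[x |-> \tr (rho x *m T)] has the same twisted symmetry as [t]. The even matrix
units contribute the scalar [s] to its action. The odd ones contribute nothing
if [C] vanishes on them; otherwise the commutant contains an odd invertible
[H], and writing [G = H *m (invmx H *m G)] reduces odd [G] to even ones, giving
another [s]. *)
Lemma central_trace_element s : mx_schur s -> s != 0 ->
  (forall H, mx_parity q true H -> commuting H -> H = 0 \/ H \in unitmx) ->
  exists (z : A) lam, [/\ homog false z, (forall x : A, z * x = x * z),
    (forall x, t (z * x) = \tr (rho x *m T)), rho z = lam%:M
    & lam = s \/ lam = 2%:R * s].
Proof.
move=> sch s0 oddH; have tl := frob_lin frob.
pose z : A := \sum_i \tr (rho (B i) *m T) *: Bd i.
have tz x : t (z * x) = \tr (rho x *m T).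
  rewrite {2}[x](frob_expand frob) (rep_sum hrho) mulmx_suml linear_sum /z mulr_suml.
  under eq_bigr => i _ do rewrite -salgZAl.
  rewrite (scalar_sum tl); apply: eq_bigr => i _.
  by rewrite /= -scalemxAl mxtraceZ mulrC.
have zeven : homog false z.
  apply: homog_sum => i _.
  have := frob_dhomog frob i; have := rep_homog hrho (frob_homog frob i).
  case: (p i) => h hd; last exact: homogZ.
  have -> : \tr (rho (B i) *m T) = 0; last by rewrite scale0r; exact: homog0.
  rewrite /mxtrace big1 // => j _; rewrite mul_mx_parity h ?mulr0 //.
  by rewrite addbb.
have zc x : z * x = x * z.
  apply/eqP; rewrite -subr_eq0; apply/eqP; rewrite [LHS](frob_dexpand frob) big1 // => i _.
  have -> : t ((z * x - x * z) * B i) = 0; last by rewrite scale0r.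
  rewrite mulrBl (scalarD_of tl) -scaleN1r (scalarZ_of tl) mulN1r; apply/eqP; rewrite subr_eq0;
    apply/eqP.
  rewrite -!mulrA [RHS](frob_twist frob) -mulrA !tz !(repM hrho) (rep_twist hrho).
  rewrite !mulmxA -(mulmxA _ T T) parity_mxK mulmx1.
  by rewrite [RHS]mxtrace_mulC !mulmxA.
have zE k l : rho z k l = s * (k == l)%:R +
    \sum_(j | q j != q l) (-1) ^+ (eps && q j) * C (delta_mx l j) k j.
  transitivity (\sum_j (-1) ^+ (eps && q j) * C (delta_mx l j) k j).
    rewrite (rep_sum hrho) summxE.
    transitivity (\sum_i \sum_j (-1) ^+ (eps && q j) * (rho (Bd i) k l * rho (B i) j j)).
      apply: eq_bigr => i _; rewrite mxE /mxtrace mulr_suml.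
      by apply: eq_bigr => j _; rewrite mul_mx_parity -mulrA (mulrC (rho (B i) j j)).
    rewrite exchange_big; apply: eq_bigr => j _ /=.
    by rewrite mx_casimir_entry mulr_sumr.
  rewrite (bigID (fun j => q j == q l)) /=; congr (_ + _).
  rewrite (bigD1 l) //= big1 ?addr0 => [|j /andP[/eqP qj jl]].
    rewrite sch ?mxtrace_delta ?eqxx ?mulr1; last first.
      by have := @mx_parity_delta F d q l l; rewrite addbb.
    rewrite mxE parity_mxE; have [->|kl] := eqVneq k l; last by rewrite !mulr0.
    by rewrite mulr1n mulrCA -signr_addb addbb.
  rewrite sch; last by have := @mx_parity_delta F d q l j; rewrite qj addbb.
  by rewrite mxtrace_delta eq_sym (negPf jl) mulr0 scale0r mxE mulr0.
have [[l1 [j1 [qlj C1]]]|nex] :=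
    classic (exists l j, q j != q l /\ C (delta_mx l j) <> 0); last first.
  exists z, s; split=> //; last by left.
  apply/matrixP=> k l; rewrite zE big1 ?addr0 ?mxE ?mulr_natr // => j qj.
  have -> : C (delta_mx l j) = 0; last by rewrite mxE mulr0.
  by apply: NNPP => h; apply: nex; exists l, j.
pose H := C (delta_mx l1 j1) *m T.
have hH : mx_parity q true H.
  have h := mx_casimir_parity hrho frob (@mx_parity_delta F d q l1 j1).
  have := mx_parityM h (@mx_parity_diag F d q eps).
  by rewrite (_ : _ (+) false = true) //; case: (q l1) (q j1) qlj => [] [].
have cH : commuting H by move=> a; exact: (mx_casimir_comm hrho frob).
have uH : H \in unitmx.
  have [H0|//] := oddH H hH cH; case: C1.
  by rewrite -[LHS]mulmx1 -(parity_mxK F q eps) mulmxA -/H H0 mul0mx.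
have CE l j : q j != q l -> C (delta_mx l j) = (s * invmx H j l) *: (H *m T).
  move=> qj; rewrite -{1}[delta_mx l j]mul1mx -(mulmxV uH) -mulmxA (mx_casimir_mull _ _ _ cH).
  rewrite sch ?mxtrace_mul_delta -?scalemxAr //.
  have := mx_parityM (mx_parity_inv uH hH) (@mx_parity_delta F d q l j).
  by rewrite (_ : _ (+) _ = false) //; case: (q l) (q j) qj => [] [].
(* The trace of [invmx H *m delta_mx l j] picks the entry [(j, l)] of [invmx H];
   summing over the odd positions rebuilds [H *m invmx H]. *)
exists z, (2%:R * s); split=> //; last by right.
apply/matrixP=> k l; rewrite zE.
transitivity (s * (k == l)%:R + s * (H *m invmx H) k l); last first.
  by rewrite mulmxV // !mxE mulr_natl mulr2n mulrnDl mulr_natr.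
congr (_ + _); rewrite [in RHS]mxE [in RHS](bigID (fun j => q j == q l)) /=.
rewrite [X in _ = _ * (X + _)]big1 ?add0r => [|j /eqP qj].
  rewrite mulr_sumr; apply: eq_bigr => j qj; rewrite CE // mxE mul_mx_parity.
  rewrite mulrCA (mulrA ((-1) ^+ _)) -signr_addb addbb mul1r -mulrA.
  by rewrite (mulrC (invmx H j l)).
by rewrite (mx_parity_inv uH hH) ?mulr0 // qj addbb.
Qed.

End MatrixSchur.

(** * Endomorphisms of a superspace as matrices *)

Section MatrixOfEnd.
Variables (F : fieldType) (V : superVectType F) (P : 'M[F]_(dim V)).
Hypothesis uP : P \in unitmx.
Implicit Types (g h : 'End(V)) (v : V).
Local Notation d := (dim V).

(** The basis attached to [P] consists of the vectors whose coordinates are its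
rows; an invertible matrix is easier to produce than a basis as a tuple. *)
Definition bvec (i : 'I_d) : V := r2v (row i P).

Definition bcoord v : 'rV[F]_d := v2r v *m invmx P.

(** The transposition makes [end_mx] multiplicative: [f2mx] acts on row vectors
and so reverses composition. *)
Definition end_mx g : 'M[F]_d := (P *m f2mx g *m invmx P)^T.

Definition mx_end (G : 'M[F]_d) : 'End(V) := Hom (invmx P *m G^T *m P).

Lemma lfun_v2r g v : v2r (g v) = v2r v *m f2mx g.
Proof. by rewrite unlock /= r2vK. Qed.

Lemma f2mx_comp g h : f2mx (g \o h)%VF = f2mx h *m f2mx g.
Proof.
apply/row_matrixP=> i; rewrite !rowE mulmxA -[delta_mx 0 i]r2vK.
by rewrite -!lfun_v2r comp_lfunE.
Qed.

Lemma f2mx1 : f2mx (\1%VF : 'End(V)) = 1%:M.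
Proof.
apply/row_matrixP=> i; rewrite !rowE mulmx1 -[delta_mx 0 i]r2vK.
by rewrite -!lfun_v2r id_lfunE.
Qed.

Lemma f2mx_linear : linear (@f2mx F V V).
Proof.
move=> a g h; apply/row_matrixP=> i; rewrite !rowE -[delta_mx 0 i]r2vK.
by rewrite mulmxDr -scalemxAr -!lfun_v2r add_lfunE scale_lfunE linearP.
Qed.

Lemma f2mx0 : f2mx (0 : 'End(V)) = 0.
Proof. exact: (linear_at0 f2mx_linear). Qed.

Lemma f2mxZ c g : f2mx (c *: g) = c *: f2mx g.
Proof. exact: (linear_atZ f2mx_linear). Qed.

Lemma end_mxK : cancel end_mx mx_end.
Proof.
move=> g; apply: (val_inj : injective f2mx); rewrite /end_mx /mx_end /= trmxK.
by rewrite !mulmxA mulVmx // mul1mx -mulmxA mulVmx // mulmx1.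
Qed.

Lemma mx_endK : cancel mx_end end_mx.
Proof.
move=> G; rewrite /end_mx /mx_end /=.
by rewrite !mulmxA mulmxV // mul1mx -mulmxA mulmxV // mulmx1 trmxK.
Qed.

Lemma end_mx_linear : linear end_mx.
Proof.
move=> a g h; rewrite /end_mx f2mx_linear mulmxDr mulmxDl -scalemxAr -scalemxAl.
by rewrite linearP.
Qed.

Lemma end_mx0 : end_mx 0 = 0.
Proof. exact: linear_at0 end_mx_linear. Qed.

Lemma end_mx_comp g h : end_mx (g \o h)%VF = end_mx g *m end_mx h.
Proof.
rewrite /end_mx f2mx_comp -trmx_mul; congr (_^T).
by rewrite !mulmxA -(mulmxA _ (invmx P) P) mulVmx // mulmx1.
Qed.

Lemma end_mx1 : end_mx \1%VF = 1%:M.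
Proof. by rewrite /end_mx f2mx1 mulmx1 mulmxV // trmx1. Qed.

Lemma end_mx_tr g : \tr (end_mx g) = ltr g.
Proof. by rewrite /end_mx mxtrace_tr mxtrace_mulC mulmxA mulVmx // mul1mx. Qed.

Lemma end_mx_scalar c : end_mx (c *: \1%VF) = c%:M.
Proof. by rewrite (linear_atZ end_mx_linear) end_mx1 scalemx1. Qed.

Lemma bcoord_linear : linear bcoord.
Proof. by move=> a u v; rewrite /bcoord linearP mulmxDl -scalemxAl. Qed.

Lemma bcoord_vec i : bcoord (bvec i) = delta_mx 0 i.
Proof. by rewrite /bcoord r2vK -row_mul mulmxV // rowE mulmx1. Qed.

Lemma bcoordK v : v = \sum_i bcoord v 0 i *: bvec i.
Proof.
apply: v2r_inj; rewrite linear_sum /=.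
under eq_bigr => i _ do rewrite linearZ /= r2vK.
by rewrite -mulmx_sum_row /bcoord -mulmxA mulVmx // mulmx1.
Qed.

Lemma bcoord_sum (c : 'I_d -> F) i : bcoord (\sum_j c j *: bvec j) 0 i = c i.
Proof.
rewrite (linear_at_sum bcoord_linear); under eq_bigr => j _ do rewrite bcoord_vec.
rewrite summxE (bigD1 i) //= big1 ?addr0 => [|j ji]; rewrite !mxE ?eqxx ?mulr1 //.
by rewrite eq_sym (negPf ji) andbF mulr0.
Qed.

Lemma end_mx_vec g j : g (bvec j) = \sum_i end_mx g i j *: bvec i.
Proof.
rewrite [LHS]bcoordK; apply: eq_bigr => i _; congr (_ *: _).
by rewrite /bcoord lfun_v2r r2vK -row_mul -row_mul /end_mx !mxE.
Qed.

Lemma end_mx_eq g (G : 'M[F]_d) :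
  (forall j, g (bvec j) = \sum_i G i j *: bvec i) -> end_mx g = G.
Proof.
move=> h; apply/matrixP=> i j; have := h j; rewrite end_mx_vec.
by move=> /(congr1 (fun v => bcoord v 0 i)); rewrite !bcoord_sum.
Qed.

Variable q : 'I_d -> bool.
Hypothesis hq : forall i, homog (q i) (bvec i).

Lemma bcoord_homog r v i : homog r v -> q i != r -> bcoord v 0 i = 0.
Proof.
move=> hv qi.
have : spart (~~ r) v = \sum_j (if q j == r then 0 else bcoord v 0 j) *: bvec j.
  rewrite {1}[v]bcoordK linear_sum; apply: eq_bigr => j _.
  rewrite linearZ /=; case: eqP => [<-|/eqP nj].
    by rewrite (homog_other (hq j)) scaler0 scale0r.
  by rewrite (_ : ~~ r = q j) ?hq //; case: r (q j) nj {hv qi} => [] [].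
rewrite (homog_other hv) => /(congr1 (fun v => bcoord v 0 i)).
by rewrite bcoord_sum (negPf qi) /bcoord linear0 mul0mx mxE.
Qed.

Lemma end_mx_parity r g : hom_parity r g -> mx_parity q r (end_mx g).
Proof.
move=> hg i j ij; rewrite -(bcoord_sum (fun i => end_mx g i j)) -end_mx_vec.
apply: (@bcoord_homog (r (+) q j)); first exact: hg.
by case: (q i) (q j) r ij {hg} => [] [] [].
Qed.

Lemma parity_end_mx r g : mx_parity q r (end_mx g) -> hom_parity r g.
Proof.
move=> hg s v hv; rewrite [v]bcoordK linear_sum; apply: homog_sum => j _.
rewrite linearZ /=; have [qj|qj] := eqVneq (q j) s; last first.
  by rewrite (bcoord_homog hv qj) scale0r; exact: homog0.
apply: homogZ; rewrite end_mx_vec; apply: homog_sum => i _.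
have [e|ne] := eqVneq (q i (+) q j) r; last by rewrite hg // scale0r; exact: homog0.
by apply: homogZ; rewrite -qj -e -addbA addbb addbF.
Qed.

(** For [eps = true] this is the parity involution, and the supertrace of [g] is
the trace of its composite with [g]. *)
Definition parity_end (eps : bool) : 'End(V) :=
  (even_part + (-1) ^+ eps *: (\1 - even_part))%VF.

Lemma end_mx_parity_end eps : end_mx (parity_end eps) = parity_mx F q eps.
Proof.
apply: end_mx_eq => j; rewrite (bigD1 j) //= big1 ?addr0 => [|i ij]; last first.
  by rewrite parity_mxE (negPf ij) mulr0n scale0r.
rewrite parity_mxE eqxx mulr1n add_lfunE scale_lfunE add_lfunE opp_lfunE id_lfunE.
have e : even_part (bvec j) = spart false (bvec j) by [].
have o : bvec j - even_part (bvec j) = spart true (bvec j) by [].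
rewrite o e; have := hq j; case: (q j) => h; rewrite (homog_other h) h.
  by rewrite add0r andbT.
by rewrite scaler0 addr0 andbF scale1r.
Qed.

Lemma suptrE g : suptr g = \tr (end_mx g *m parity_mx F q true).
Proof.
rewrite -end_mx_parity_end -end_mx_comp end_mx_tr /suptr.
have -> : (g \o parity_end true)%VF =
    (-1) *: (g \o (\1 - even_part))%VF + (g \o even_part)%VF.
  apply/lfunP=> v; rewrite add_lfunE scale_lfunE !comp_lfunE.
  by rewrite /parity_end add_lfunE scale_lfunE linearD linearZ /= addrC.
by rewrite /ltr f2mx_linear mxtraceD mxtraceZ mulN1r addrC.
Qed.

End MatrixOfEnd.

(** * Simple modules and their Schur elements *)

Lemma hom_parity_spart (F : fieldType) (V W : superVectType F) r (g : 'Hom(V, W)) s v :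
  hom_parity r g -> g (spart s v) = spart (r (+) s) (g v).
Proof.
move=> hg; rewrite [in RHS](spartD v) [in RHS]linearD linearD /=.
have hF := hg false _ (spart_homog false v); have hT := hg true _ (spart_homog true v).
rewrite addbC /= in hF; rewrite addbC /= in hT.
case: s; first by rewrite addbT hT -{1}[r]negbK (homog_other _) ?add0r ?negbK //.
by rewrite addbF hF (_ : spart r (g (spart true v)) = 0) ?addr0 // -{1}[r]negbK (homog_other hT).
Qed.

Section Roots.
Variable F : fieldType.

Lemma exists_irreducible_factor (p : {poly F}) : (1 < size p)%N ->
  exists r, irreducible_poly r /\ r %| p.
Proof.
have [m] := ubnP (size p); elim: m p => // m IH p lem p1.
have [[r [r1 rp nrp]]|irr] := classic (exists r : {poly F}, [/\ size r != 1%N, r %| p & ~~ (r %= p)]).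
  have p0 : p != 0 by rewrite -size_poly_gt0 ltnW.
  have r0 : r != 0 by apply: contraNneq p0 => r0; rewrite r0 dvd0p in rp.
  have [||s [irs sr]] := IH r.
  - rewrite -ltnS (leq_trans _ lem) // ltnS ltn_neqAle dvdp_leq // andbT.
    by rewrite dvdp_size_eqp.
  - by rewrite ltn_neqAle eq_sym r1 size_poly_gt0.
  by exists s; split=> //; apply: dvdp_trans rp.
exists p; split=> //; split=> // r r1 rp; apply: NNPP => /negP nrp.
by apply: irr; exists r.
Qed.

(** An irreducible factor acquires a root in the field it defines. *)
Lemma exists_extension_root (p : {poly F}) : (1 < size p)%N ->
  exists (L : fieldType) (f : {rmorphism F -> L}) (z : L), root (map_poly f p) z.
Proof.
move=> /exists_irreducible_factor[r [irr rp]].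
have [L _ [z rz _]] := irredp_FAdjoin irr.
exists L, (in_alg L), z; move: rz; rewrite -!dvdp_XsubCl => rz; apply: (dvdp_trans rz).
by rewrite dvdp_map.
Qed.

End Roots.

Lemma simple_dim (F : fieldType) (A : superalgebra F) (V : supermodule A) :
  simple_smod V -> (0 < dim V)%N.
Proof.
case=> V0 _; rewrite lt0n; apply: contraNneq V0 => d0; rewrite -subv0; apply/subvP=> v _.
rewrite memv0 -[v]v2rK; apply/eqP; rewrite -[RHS](linear0 r2v); congr r2v.
by apply/rowP=> i; have := ltn_ord i; rewrite [X in (_ < X)%N]d0.
Qed.

Section SplitEnd.
Variables (F : fieldType) (A : superalgebra F) (V : supermodule A).

Lemma ext_homE_mx (L : fieldType) (f : {rmorphism F -> L}) (g : 'End(V)) (w : ext f V) :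
  ext_hom f g w = ((w : 'rV_(dim V)) *m map_mx f (f2mx g)) :> 'rV_(dim V).
Proof.
rewrite lfunE /= /ext_lin mulmx_sum_row; apply: eq_bigr => i _; congr (_ *: _).
by rewrite /ext_in lfun_v2r /std_basis r2vK -rowE map_row.
Qed.

(** Over an extension [L] in which [g] has an eigenvalue [z], the eigenspace is a
nonzero graded submodule of the extended module, which is still simple. So [g]
is the scalar [z], and [z] is a matrix entry of [g], hence lies in [F]. *)
Lemma split_even_end (g : 'End(V)) : simple_smod V -> split_smod V ->
  hom_parity false g -> (forall a v, g (smod_act V a v) = smod_act V a (g v)) ->
  exists c, g = c *: \1%VF.
Proof.
move=> sV spl hg cg; have dV := simple_dim sV.
have [|L [f [z rz]]] := @exists_extension_root F (char_poly (f2mx g)).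
  by rewrite size_char_poly ltnS.
rewrite map_char_poly -eigenvalue_root_char in rz.
have /eigenvalueP[w wg w0] := rz.
have [_ simp] := spl L f.
pose h : 'End(ext_smod f V) := ext_hom f g - z *: \1%VF.
have hE v : h v = ext_hom f g v - z *: v.
  by rewrite add_lfunE opp_lfunE scale_lfunE id_lfunE.
have comm (k : 'End(ext_smod f V)) :
    (ext_hom f g \o k)%VF = (k \o ext_hom f g)%VF -> forall v, v \in lker h -> k v \in lker h.
  move=> ck v; rewrite !memv_ker !hE -comp_lfunE ck comp_lfunE -linearZ -linearB /=.
  by move/eqP->; rewrite linear0.
have [] := simp (lker h).
- split.
    apply: comm; rewrite -!ext_hom_comp; congr (ext_hom _ _).
    apply/lfunP=> v; rewrite !comp_lfunE.
    exact: (hom_parity_spart false v hg).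
  move=> a; apply: comm; elim/ext_ind: a => [|c a x IH].
    by rewrite [smod_act _ _]ext_act0 comp_lfun0l comp_lfun0r.
  rewrite [smod_act _ _]ext_act_linear comp_lfunDr comp_lfunDl -comp_lfunZr -comp_lfunZl.
  congr (_ *: _ + _); last exact: IH.
  rewrite ext_act_in -!ext_hom_comp; congr (ext_hom _ _).
  by apply/lfunP=> v; rewrite !comp_lfunE.
- move=> k0; have : (w : ext_smod f V) \in lker h.
    by rewrite memv_ker hE ext_homE_mx wg subrr.
  by rewrite k0 memv0 (negPf w0).
move=> kT; pose i0 := Ordinal dV; exists (f2mx g i0 i0).
have ent i j : f (f2mx g i j) = z *+ (i == j).
  have : ext_in f (std_basis (V := V) i) \in lker h by rewrite kT memvf.
  rewrite memv_ker hE ext_homE_mx subr_eq0 => /eqP /(congr1 (fun u : 'rV_(dim V) => u 0 j)).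
  rewrite /ext_in /std_basis r2vK map_delta_mx -rowE !mxE eqxx /= => ->.
  by rewrite eq_sym mulr_natr.
apply: (val_inj : injective f2mx); rewrite /=.
rewrite f2mxZ f2mx1 scalemx1.
apply/matrixP=> i j; apply: (fmorph_inj f).
by rewrite ent mxE rmorphMn /= ent eqxx mulr1n.
Qed.

Lemma simple_homog_end (g : 'End(V)) r : simple_smod V ->
  hom_parity r g -> (forall a v, g v = 0 -> g (smod_act V a v) = 0) ->
  g = 0 \/ f2mx g \in unitmx.
Proof.
move=> [_ simp] hg cg; case: (simp (lker g)) => [|k0|kT].
- split=> [v|a v]; rewrite !memv_ker => /eqP gv; apply/eqP; last exact: cg.
  by rewrite (hom_parity_spart false v hg) gv linear0.
- right; rewrite -row_free_unit -kermx_eq0; apply/eqP/row_matrixP=> i.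
  have : r2v (row i (kermx (f2mx g))) \in lker g.
    by rewrite memv_ker -(inj_eq (@v2r_inj _ _)) lfun_v2r r2vK -row_mul mulmx_ker row0 linear0.
  rewrite k0 memv0 => /eqP /(congr1 v2r); rewrite r2vK linear0 => ->.
  by rewrite row0.
left; apply/lfunP=> v; rewrite zero_lfunE; apply/eqP; rewrite -memv_ker kT; exact: memvf.
Qed.

End SplitEnd.

Section ModuleRep.
Variables (F : fieldType) (A : superalgebra F) (V : supermodule A).
Variables (P : 'M[F]_(dim V)) (q : 'I_(dim V) -> bool).
Hypotheses (uP : P \in unitmx) (hq : forall i, homog (q i) (bvec P i)).

Definition smod_mx (x : A) : 'M[F]_(dim V) := end_mx P (smod_act V x).

Lemma smod_actD (x y : A) : smod_act V (x + y) = smod_act V x + smod_act V y.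
Proof. exact: (linear_atD (smod_act_linear V)). Qed.

Lemma smod_actZ c (x : A) : smod_act V (c *: x) = c *: smod_act V x.
Proof. exact: (linear_atZ (smod_act_linear V)). Qed.

Lemma smod_mx_rep : graded_mx_rep q smod_mx.
Proof.
split.
- by move=> c x y; rewrite /smod_mx smod_act_linear end_mx_linear.
- by rewrite /smod_mx smod_act1 end_mx1.
- by move=> x y; rewrite /smod_mx smod_actM end_mx_comp.
- by move=> r x hx; apply: end_mx_parity => //; apply: smod_act_homog.
Qed.

Lemma even_end_scalar (H : 'M[F]_(dim V)) : simple_smod V -> split_smod V ->
  mx_parity q false H -> (forall a, smod_mx a *m H = H *m smod_mx a) ->
  exists c, H = c%:M.
Proof.
move=> sV spl hH cH; have [||c gc] := @split_even_end _ _ V (mx_end P H) sV spl.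
- by apply: (parity_end_mx uP hq); rewrite mx_endK.
- move=> a v; rewrite -!comp_lfunE; congr (fun_of_lfun _ v).
  by apply: (can_inj (end_mxK uP)); rewrite !end_mx_comp // mx_endK // cH.
by exists c; rewrite -[H](mx_endK uP) gc end_mx_scalar.
Qed.

Lemma odd_end_unit r (H : 'M[F]_(dim V)) : simple_smod V ->
  mx_parity q r H -> (forall a, smod_mx a *m H = H *m smod_mx a) ->
  H = 0 \/ H \in unitmx.
Proof.
move=> sV hH cH; have [||g0|ug] := @simple_homog_end _ _ V (mx_end P H) r sV.
- by apply: (parity_end_mx uP hq); rewrite mx_endK.
- move=> a v gv; rewrite -comp_lfunE.
  have -> : (mx_end P H \o smod_act V a)%VF = (smod_act V a \o mx_end P H)%VF.
    by apply: (can_inj (end_mxK uP)); rewrite !end_mx_comp // mx_endK // cH.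
  by rewrite comp_lfunE gv linear0.
- by left; rewrite -[H](mx_endK uP) g0 end_mx0.
right; move: ug; rewrite /mx_end /= !unitmx_mul unitmx_inv unitmx_tr.
by case/andP=> /andP[].
Qed.

Variables (eps : bool) (t : A -> F) (n : nat) (p : 'I_n -> bool) (B Bd : 'I_n -> A).
Hypothesis frob : frobenius_system eps t p B Bd.

(** The element [\sum_b b^v (x) b] does not depend on the basis. *)
Lemma mx_casimir_indep m (B' Bd' : 'I_m -> A) G :
  (forall y, exists c : 'I_m -> F, y = \sum_i c i *: B' i) ->
  (forall i j, t (Bd' i * B' j) = (i == j)%:R) ->
  mx_casimir smod_mx B' Bd' G = mx_casimir smod_mx B Bd G.
Proof.
move=> bas dual; have tl := frob_lin frob; have hr := smod_mx_rep.
have ex y : y = \sum_i t (Bd' i * y) *: B' i.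
  have [c yE] := bas y; rewrite {1}yE; apply: eq_bigr => i _; congr (_ *: _).
  rewrite yE mulr_sumr; under eq_bigr => j _ do rewrite -salgZAr.
  rewrite (scalar_sum tl) (bigD1 i) //= dual eqxx mulr1 big1 ?addr0 // => j ji.
  by rewrite dual eq_sym (negPf ji) mulr0.
transitivity (\sum_i \sum_j t (Bd' i * B j) *: (smod_mx (Bd j) *m G *m smod_mx (B' i))).
  apply: eq_bigr => i _; rewrite {1}[Bd' i](frob_dexpand frob) (rep_sum hr).
  by rewrite !mulmx_suml; apply: eq_bigr => j _; rewrite -!scalemxAl.
rewrite exchange_big; apply: eq_bigr => j _ /=.
rewrite {2}[B j]ex (rep_sum hr) mulmx_sumr.
by apply: eq_bigr => i _; rewrite -scalemxAr.
Qed.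

Lemma frobenius_hbasis : is_hbasis p B.
Proof.
have tl := frob_lin frob; split; first exact: (frob_homog frob).
move=> v; exists (\row_i t (Bd i * v)); split.
  by rewrite {1}[v](frob_expand frob); apply: eq_bigr => i _; rewrite mxE.
move=> c vE; apply/rowP=> i; rewrite mxE vE mulr_sumr.
under eq_bigr => j _ do rewrite -salgZAr.
rewrite (scalar_sum tl) (bigD1 i) //= (frob_dual frob) eqxx mulr1 big1 ?addr0 // => j ji.
by rewrite (frob_dual frob) eq_sym (negPf ji) mulr0.
Qed.

Lemma hbasis_span m (p' : 'I_m -> bool) (B' : 'I_m -> A) : is_hbasis p' B' ->
  forall y : A, exists c : 'I_m -> F, y = \sum_i c i *: B' i.
Proof. by case=> _ h y; have [c [yE _]] := h y; exists (c 0). Qed.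

Lemma end_mx_casimir m (B' Bd' : 'I_m -> A) g :
  end_mx P (casimir B' Bd' g) = mx_casimir smod_mx B' Bd' (end_mx P g).
Proof.
rewrite /casimir; under eq_bigr => i _ do rewrite -[(_ \o _)%VF]scale1r.
rewrite (linear_at_sum (end_mx_linear P)); apply: eq_bigr => i _.
by rewrite scale1r !end_mx_comp.
Qed.

(** The sign of [b] is absorbed by conjugating [rho b] by the parity matrix. *)
Lemma end_mx_supercasimir m (p' : 'I_m -> bool) (B' Bd' : 'I_m -> A) g :
  (forall i, homog (p' i) (B' i)) ->
  end_mx P (supercasimir p' B' Bd' g) =
  mx_casimir smod_mx B' Bd' (end_mx P g *m parity_mx F q true) *m parity_mx F q true.
Proof.
move=> hB; rewrite /supercasimir (linear_at_sum (end_mx_linear P)) mulmx_suml;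
  apply: eq_bigr => i _.
rewrite !end_mx_comp // -!mulmxA !scalemxAr; congr (_ *m (_ *m _)).
by rewrite mulmxA (mx_parity_comm _ (rep_homog smod_mx_rep (hB i))).
Qed.

Variable i0 : 'I_(dim V).

Definition schur_elt (s : F) : Prop :=
  if eps then super_schur_element t V s else schur_element t V s.

(** In the super case apply the defining identity to [G *m T] in place of [G]:
its supertrace is [\tr G]. A diagonal matrix unit, even and of trace [1],
gives uniqueness. *)
Lemma schur_eltP s : schur_elt s <-> mx_schur q smod_mx eps B Bd s.
Proof.
have hb := frobenius_hbasis; have dual : is_dual_basis t B Bd := frob_dual frob.
have d00 : mx_parity q false (delta_mx i0 i0 : 'M[F]_(dim V)).
  by have := @mx_parity_delta F (dim V) q i0 i0; rewrite addbb.
have uniqs s1 s2 : mx_schur q smod_mx eps B Bd s1 -> mx_schur q smod_mx eps B Bd s2 -> s1 = s2.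
  move=> /(_ _ d00) h1 /(_ _ d00); rewrite h1 mxtrace_delta eqxx !mulr1.
  move=> /(congr1 (fun M : 'M_(dim V) => (M *m parity_mx F q eps) i0 i0)).
  by rewrite -!scalemxAl parity_mxK !mxE eqxx !mulr1.
have indep m (p' : 'I_m -> bool) (B' Bd' : 'I_m -> A) G :
    is_hbasis p' B' -> is_dual_basis t B' Bd' ->
    mx_casimir smod_mx B' Bd' G = mx_casimir smod_mx B Bd G.
  by move=> hb' dual'; apply: mx_casimir_indep => //; apply: hbasis_span hb'.
have lfun_par G r : mx_parity q r G -> hom_parity r (mx_end P G).
  by move=> hG; apply: (parity_end_mx uP hq); rewrite mx_endK.
have mx_par g r : hom_parity r g -> mx_parity q r (end_mx P g) by apply: end_mx_parity.
rewrite /schur_elt; case e: eps in uniqs *.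
- have toT s' : (forall n (p : 'I_n -> bool) (B Bd : 'I_n -> A) (g : 'End(V)),
      is_hbasis p B -> is_dual_basis t B Bd -> hom_parity false g ->
      supercasimir p B Bd g = (s' * suptr g) *: \1%VF) -> mx_schur q smod_mx true B Bd s'.
    move=> h G hG.
    have hGT : mx_parity q false (G *m parity_mx F q true).
      exact: (mx_parityM hG (@mx_parity_diag F _ q true)).
    have := h _ _ _ _ _ hb dual (lfun_par _ _ hGT) => /(congr1 (end_mx P)).
    rewrite end_mx_supercasimir ?end_mx_scalar ?(suptrE uP hq) ?mx_endK //; last by case: hb.
    rewrite -mulmxA parity_mxK mulmx1 => /(congr1 (fun M => M *m parity_mx F q true)).
    by rewrite -mulmxA parity_mxK mulmx1 mul_scalar_mx.
  split=> [[h _]|h]; first exact: toT.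
  split=> [m p' B' Bd' g hb' dual' hg|s' hs']; last exact: uniqs (toT _ hs').
  apply: (can_inj (end_mxK uP)); rewrite end_mx_scalar // end_mx_supercasimir; last by case: hb'.
  rewrite (indep _ _ _ _ _ hb' dual') h; last first.
    exact: (mx_parityM (mx_par _ _ hg) (@mx_parity_diag F _ q true)).
  by rewrite -scalemxAl parity_mxK -suptrE // scalemx1.
have toT s' : (forall n (p : 'I_n -> bool) (B Bd : 'I_n -> A) (g : 'End(V)),
    is_hbasis p B -> is_dual_basis t B Bd -> hom_parity false g ->
    casimir B Bd g = (s' * ltr g) *: \1%VF) -> mx_schur q smod_mx false B Bd s'.
  move=> h G hG; have := h _ _ _ _ _ hb dual (lfun_par _ _ hG) => /(congr1 (end_mx P)).
  by rewrite end_mx_casimir end_mx_scalar // -(end_mx_tr uP) mx_endK // parity_mx_false scalemx1.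
split=> [[h _]|h]; first exact: toT.
split=> [m p' B' Bd' g hb' dual' hg|s' hs']; last exact: uniqs (toT _ hs').
apply: (can_inj (end_mxK uP)); rewrite end_mx_scalar // end_mx_casimir.
rewrite (indep _ _ _ _ _ hb' dual') h; last exact: mx_par.
by rewrite end_mx_tr // parity_mx_false scalemx1.
Qed.

End ModuleRep.

(** * Fractions over a valuation ring *)

Section Valuation.
Variables (O : idomainType).
Hypothesis dvr : is_dvr O.
Local Notation K := {fraction O}.
Local Notation iota := (@FracField.tofrac O).

(** If [g] generates the ideal of [a] and [b], then [1] is a combination of
[a / g] and [b / g], one of which must be a unit as the ring is local. *)
Lemma dvr_div (a b : O) : (exists c, a = c * b) \/ (exists c, b = c * a).
Proof.
have [bezout loc _] := dvr.
pose I x := exists u v, x = u * a + v * b.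
have [|_ _ [u [v ->]] [u' [v' ->]]|c _ [u [v ->]]|g Ig] := bezout I.
- by exists 0, 0; rewrite !mul0r addr0.
- by exists (u + u'), (v + v'); rewrite !mulrDl addrACA.
- by exists (c * u), (c * v); rewrite mulrDr !mulrA.
have [a' aE] : exists c, a = c * g by apply/Ig; exists 1, 0; rewrite mul1r mul0r addr0.
have [b' bE] : exists c, b = c * g by apply/Ig; exists 0, 1; rewrite mul1r mul0r add0r.
have [u [v gE]] : I g by apply/Ig; exists 1; rewrite mul1r.
have [g0|g0] := eqVneq g 0; first by left; exists 0; rewrite mul0r aE g0 mulr0.
have one : 1 = u * a' + v * b'.
  by apply: (mulIf g0); rewrite mul1r mulrDl -!mulrA -aE -bE.
have [ua|nua] := boolP (a' \is a GRing.unit).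
  right; exists (b' / a'); rewrite aE mulrA divrK //.
have [ub|nub] := boolP (b' \is a GRing.unit).
  left; exists (a' / b'); rewrite bE mulrA divrK //.
have := loc (u * a') (v * b'); rewrite -one unitr1 !unitrM (negPf nua) (negPf nub) !andbF.
by move=> /(_ isT isT).
Qed.

Lemma fraction_repr (x : K) : exists a b, b != 0 /\ x * iota b = iota a.
Proof.
exists (\n_(repr x)), (\d_(repr x)); split; first exact: denom_ratioP.
rewrite -{1}[x]reprK; unlock FracField.tofrac; rewrite -[LHS]FracField.pi_mul.
apply/eqmodP;
  by rewrite /= FracField.equivfE /FracField.mulf !numden_Ratio ?mulr1 ?oner_eq0 ?denom_ratioP // mulrC eqxx.
Qed.

Lemma map_tofrac_inj m l : injective (map_mx iota : 'M_(m, l) -> 'M_(m, l)).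
Proof.
move=> X Y /matrixP XY; apply/matrixP=> i j.
by have := XY i j; rewrite !mxE => /eqP; rewrite tofrac_eq => /eqP.
Qed.

Definition integral_elt (x : K) : Prop := exists c, x = iota c.

Lemma integralD x y : integral_elt x -> integral_elt y -> integral_elt (x + y).
Proof. by move=> [a ->] [b ->]; exists (a + b); rewrite rmorphD. Qed.

Lemma integralM x y : integral_elt x -> integral_elt y -> integral_elt (x * y).
Proof. by move=> [a ->] [b ->]; exists (a * b); rewrite rmorphM. Qed.

Lemma integral_sum I (r : seq I) (Q : pred I) (f : I -> K) :
  (forall i, Q i -> integral_elt (f i)) -> integral_elt (\sum_(i <- r | Q i) f i).
Proof.
move=> h; elim/big_ind: _ => //; last exact: integralD.
by exists 0; rewrite rmorph0.
Qed.

Lemma valuation_total (x y : K) :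
  (exists c, x = iota c * y) \/ (exists c, y = iota c * x).
Proof.
have [a [b [b0 xb]]] := fraction_repr x; have [a' [b' [b'0 yb']]] := fraction_repr y.
have ib : iota b != 0 by rewrite tofrac_eq0.
have ib' : iota b' != 0 by rewrite tofrac_eq0.
have ibb := mulf_neq0 ib ib'.
have [[c e]|[c e]] := dvr_div (a * b') (a' * b); [left | right]; exists c;
  apply: (mulIf ibb); move/(congr1 iota): e; rewrite !(rmorphM iota) /= -xb -yb' => e.
  transitivity (x * iota b * iota b'); first by ring.
  by rewrite e; ring.
transitivity (y * iota b' * iota b); first by ring.
by rewrite e; ring.
Qed.

Lemma valuation_min (I : eqType) (s : seq I) (w : I -> K) : s != [::] ->
  exists2 i, i \in s & forall j, j \in s -> exists c, w j = iota c * w i.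
Proof.
elim: s => // i s IH _; have [->|/IH[j js jmin]] := eqVneq s [::].
  exists i; rewrite ?mem_head // => j; rewrite inE => /eqP ->.
  by exists 1; rewrite rmorph1 mul1r.
have [[c wi]|[c wj]] := valuation_total (w i) (w j).
  exists j; first by rewrite inE js orbT.
  by move=> l; rewrite inE => /predU1P[->|/jmin //]; exists c.
exists i; first exact: mem_head.
move=> l; rewrite inE => /predU1P[->|/jmin[c' wl]].
  by exists 1; rewrite rmorph1 mul1r.
by exists (c' * c); rewrite wl wj rmorphM mulrA.
Qed.

(** Cramer's rule: replacing row [j] does not affect the cofactors of row [j]. *)
Lemma replace_row_det N d (W : 'M[K]_(N, d)) (f : {ffun 'I_d -> 'I_N}) i j :
  (row i W *m \adj (rowsub f W)) 0 j =
  \det (rowsub [ffun l => if l == j then i else f l] W).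
Proof.
rewrite (expand_det_row _ j) mxE; apply: eq_bigr => l _.
rewrite !mxE ffunE eqxx; congr (_ * _).
rewrite /cofactor; congr (_ * \det _); apply/matrixP=> a b.
by rewrite !mxE ffunE eq_sym (negPf (neq_lift _ _)).
Qed.

(** Choose [d] rows whose minor divides all the other maximal minors. By Cramer's
rule the coordinates of any row with respect to them are quotients of minors. *)
Lemma integral_basis N d (W : 'M[K]_(N, d)) : row_full W ->
  exists f : 'I_d -> 'I_N, rowsub f W \in unitmx /\
    forall i j, integral_elt ((row i W *m invmx (rowsub f W)) 0 j).
Proof.
move=> fW; pose w (f : {ffun 'I_d -> 'I_N}) := \det (rowsub f W).
have [|f _ fmin] := @valuation_min _ (enum {ffun 'I_d -> 'I_N}) w.
  have : fullrankfun fW \in enum {ffun 'I_d -> 'I_N} by rewrite mem_enum.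
  by case: (enum _).
have uf : rowsub f W \in unitmx.
  rewrite unitmxE unitfE; have := fullrowsub_unit fW; rewrite unitmxE unitfE.
  apply: contraNneq => w0.
  have [|c e] := fmin (fullrankfun fW); first by rewrite mem_enum.
  by rewrite -/(w (fullrankfun fW)) e /w w0 mulr0 eqxx.
exists f; split=> // i j.
have [|c e] := fmin [ffun l => if l == j then i else f l]; first by rewrite mem_enum.
exists c; rewrite /invmx uf -scalemxAr mxE replace_row_det.
rewrite -[\det (rowsub [ffun _ => _] W)]/(w _) e -/(w f).
rewrite mulrC mulfK // -unitfE -unitmxE //.
Qed.

End Valuation.

(** * Lattices in modules over the fraction field *)

Section ExtendRep.
Variables (R S : comNzRingType) (f : {rmorphism R -> S}) (A : superalgebra R).
Variables (d : nat) (q : 'I_d -> bool) (rho : A -> 'M[R]_d).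
Hypothesis hrho : graded_mx_rep q rho.

Definition ext_rep (x : ext_salg f A) : 'M[S]_d :=
  ext_lin (f := f) (fun a : A => map_mx f (rho a)) x.

Lemma ext_rep_linear : linear ext_rep.
Proof. exact: ext_lin_linear. Qed.

Lemma ext_rep_in a : ext_rep (salg_in f a) = map_mx f (rho a).
Proof.
apply: (ext_lin_in (f := f) (g := fun a : A => map_mx f (rho a))) => c x y.
by rewrite (rep_linear hrho) map_mxD map_mxZ.
Qed.


Lemma ext_repP : graded_mx_rep q ext_rep.
Proof.
have lin := ext_rep_linear.
have e0 : ext_rep 0 = 0 by exact: linear_at0 lin.
split=> //.
- by rewrite -(salg_in1 f A) ext_rep_in (rep1 hrho) map_mx1.
- move=> x y; elim/salg_in_ind: x => [|c a x IHx].
    by rewrite mul0r e0 mul0mx.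
  rewrite mulrDl -salgZAl !lin mulmxDl -scalemxAl IHx; congr (_ *: _ + _).
  elim/salg_in_ind: y {IHx} => [|c' b y IHy].
    by rewrite mulr0 e0 mulmx0.
  rewrite mulrDr -salgZAr !lin mulmxDr -scalemxAr IHy -salg_inM !ext_rep_in.
  by rewrite (repM hrho) map_mxM.
move=> r x; move: x; apply: (ext_homog_ind (f := f)) => [|c a x ha IH] i j ij.
  by rewrite [ext_rep _]e0 mxE.
rewrite [ext_rep _]lin mxE (IH _ _ ij) addr0 mxE [ext_rep _]ext_rep_in mxE.
by rewrite (rep_homog hrho ha ij) rmorph0 mulr0.
Qed.

End ExtendRep.

Section Lattice.
Variables (O : idomainType).
Hypothesis dvr : is_dvr O.
Local Notation K := {fraction O}.
Local Notation iota := (@FracField.tofrac O).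
Variables (A : superalgebra O) (V : supermodule (ext_salg iota A)).
Local Notation I := ('I_(dim A) * bool * ('I_(dim V) * bool))%type.
Local Notation act a := (smod_act V (salg_in iota a)).

(** Homogeneous generators of an [A]-stable lattice: the images of the homogeneous
parts of a basis of [V] under those of a basis of [A]. A basis chosen among
them is homogeneous automatically. *)
Definition lattice_gen (x : I) : V :=
  act (spart x.1.2 (std_basis (V := A) x.1.1) : A)
      (spart x.2.2 (r2v (delta_mx 0 x.2.1) : V)).

Lemma act_linear c (a b : A) : act (c *: a + b) = iota c *: act a + act b.
Proof. by rewrite salg_in_linear smod_act_linear. Qed.

Lemma act_lattice_span (a : A) j r :
  exists c : I -> O, act a (spart r (r2v (delta_mx 0 j))) = \sum_x iota (c x) *: lattice_gen x.
Proof.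
pose u := spart r (r2v (delta_mx 0 j)) : V.
have actD (x y : A) : act (x + y) u = act x u + act y u.
  by rewrite -[x]scale1r act_linear rmorph1 !scale1r add_lfunE.
have span_gen i s : exists c : I -> O,
    act (spart s (std_basis (V := A) i) : A) u = \sum_x iota (c x) *: lattice_gen x.
  exists (fun x => (x == (i, s, (j, r)))%:R).
  rewrite (bigD1 (i, s, (j, r))) //= eqxx rmorph1 scale1r big1 ?addr0 // => x nx.
  by rewrite (negPf nx) rmorph0 scale0r.
have spanD (v w : V) : (exists c : I -> O, v = \sum_x iota (c x) *: lattice_gen x) ->
    (exists c : I -> O, w = \sum_x iota (c x) *: lattice_gen x) ->
    exists c : I -> O, v + w = \sum_x iota (c x) *: lattice_gen x.
  move=> [c ->] [c' ->]; exists (fun x => c x + c' x); rewrite -big_split.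
  by apply: eq_bigr => x _; rewrite rmorphD scalerDl.
rewrite [a]std_basis_sum; elim/big_ind: _ => [|x y IHx IHy|i _].
- exists (fun=> 0); rewrite big1 => [|x _]; last by rewrite rmorph0 scale0r.
  have := act_linear (-1) 0 0; rewrite scaler0 addr0 rmorphN1 scaleN1r => ->.
  by rewrite addNr zero_lfunE.
- by rewrite actD; apply: spanD.
have [c cE] : exists c : I -> O, act (std_basis i) u = \sum_x iota (c x) *: lattice_gen x.
  rewrite [std_basis i]spartD actD; apply: spanD; exact: span_gen.
exists (fun x => v2r a 0 i * c x).
have := act_linear (v2r a 0 i) (std_basis i) 0; rewrite !addr0 => ->.
have := act_linear (-1) 0 0; rewrite scaler0 addr0 rmorphN1 scaleN1r addNr => ->.
rewrite addr0 scale_lfunE cE scaler_sumr; apply: eq_bigr => x _.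
by rewrite rmorphM scalerA.
Qed.

(** The generators span an [A]-stable lattice; [integral_basis] selects an
[O]-basis of it among them. *)
Lemma exists_lattice : exists (P : 'M[K]_(dim V)) (q : 'I_(dim V) -> bool)
    (R : A -> 'M[O]_(dim V)),
  [/\ P \in unitmx, (forall i, homog (q i) (bvec P i)), graded_mx_rep q R &
      forall a, smod_mx P (salg_in iota a) = map_mx iota (R a)].
Proof.
(* The generators as the rows of a matrix, of full rank because [1] acts as the
   identity. *)
pose W : 'M[K]_(#|{: I}|, dim V) := \matrix_i v2r (lattice_gen (enum_val i)).
have rowW x : row (enum_rank x) W = v2r (lattice_gen x) by rewrite rowK enum_rankK.
have fW : row_full W.
  rewrite -sub1mx; apply/row_subP=> j; rewrite row1.
  have -> : delta_mx 0 j = v2r (\sum_r act 1 (spart r (r2v (delta_mx 0 j) : V))).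
    rewrite big_bool /= addrC [salg_in _ _](salg_in1 iota A) smod_act1 !id_lfunE.
    by rewrite -spartD r2vK.
  rewrite linear_sum; apply: summx_sub => r _ /=.
  have [c ->] := act_lattice_span 1 j r.
  rewrite linear_sum; apply: summx_sub => x _ /=; rewrite linearZ scalemx_sub //=.
  by rewrite -rowW row_sub.
have [f [uP intP]] := integral_basis dvr fW.
set P := rowsub f W in uP intP; pose g i : I := enum_val (f i).
pose q i : bool := (g i).1.2 (+) (g i).2.2.
have bE i : bvec P i = lattice_gen (g i).
  rewrite /bvec (_ : row i P = v2r (lattice_gen (g i))) ?v2rK //.
  by apply/rowP=> j; rewrite !mxE.
have hq i : homog (q i) (bvec P i).
  rewrite bE; apply: smod_act_homog; last exact: spart_homog.
  exact: salg_in_homog (spart_homog _ _).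
have hint a i j : integral_elt (smod_mx P (salg_in iota a) i j).
  rewrite -(bcoord_sum uP (fun i => smod_mx P (salg_in iota a) i j)) -(end_mx_vec uP).
  rewrite bE /lattice_gen -comp_lfunE -smod_actM -salg_inM.
  have [c ->] := act_lattice_span (a * (spart (g j).1.2 (std_basis (V := A) (g j).1.1) : A)) (g j).2.1 (g j).2.2.
  rewrite /bcoord linear_sum mulmx_suml summxE; apply: integral_sum => x _.
  rewrite linearZ /= -scalemxAl mxE; apply: integralM; first by eexists.
  by rewrite -rowW; apply: intP.
have hint' a i j : exists c, smod_mx P (salg_in iota a) i j == iota c.
  by have [c ->] := hint a i j; exists c.
pose R a := \matrix_(i, j) xchoose (hint' a i j).
have RE a : smod_mx P (salg_in iota a) = map_mx iota (R a).
  by apply/matrixP=> i j; rewrite [RHS]mxE [R a i j]mxE; apply/eqP/(xchooseP (hint' a i j)).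
have hr := smod_mx_rep uP hq.
exists P, q, R; split=> //; split.
- move=> c a b; apply: map_tofrac_inj; rewrite -RE salg_in_linear (rep_linear hr) !RE.
  by rewrite map_mxD map_mxZ.
- by apply: map_tofrac_inj; rewrite -RE salg_in1 (rep1 hr) map_mx1.
- by move=> a b; apply: map_tofrac_inj; rewrite -RE salg_inM (repM hr) !RE map_mxM.
- move=> r a ha i j ij; have := rep_homog hr (salg_in_homog iota ha) ij.
  by rewrite RE mxE => /eqP; rewrite tofrac_eq0 => /eqP.
Qed.

End Lattice.

(** * Simple submodules and central idempotents *)

Section SubSpace.
Variables (F : fieldType) (V : superVectType F) (U : {vspace V}).

(** A copy of [subvs_of U] that records the stability of [U], so that the induced
grading can be attached to the type. *)
Definition super_subvs (hU : forall v, v \in U -> even_part v \in U) : Type := subvs_of U.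

Variable hU : forall v, v \in U -> even_part v \in U.

HB.instance Definition _ := Vector.copy (super_subvs hU) (subvs_of U).

Definition sub_val : 'Hom(super_subvs hU, V) := linfun (vsval : subvs_of U -> V).
Definition sub_proj : 'Hom(V, super_subvs hU) := linfun (vsproj U : V -> subvs_of U).

Lemma sub_valP w : sub_val w \in U.
Proof. by rewrite lfunE; exact: subvsP. Qed.

Lemma sub_val_inj : injective sub_val.
Proof. by move=> x y; rewrite !lfunE => /subvs_inj. Qed.

Lemma sub_projK v : v \in U -> sub_val (sub_proj v) = v.
Proof. by move=> Uv; rewrite !lfunE /= vsprojK. Qed.

Definition sub_even : 'End(super_subvs hU) := (sub_proj \o even_part \o sub_val)%VF.

Lemma sub_evenE w : sub_val (sub_even w) = even_part (sub_val w).
Proof. by rewrite !comp_lfunE sub_projK // hU // sub_valP. Qed.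

Lemma sub_even_idem : (sub_even \o sub_even)%VF = sub_even.
Proof.
apply/lfunP=> w; apply: sub_val_inj; rewrite comp_lfunE !sub_evenE.
by rewrite -comp_lfunE even_part_idem.
Qed.

HB.instance Definition _ := Vector_isSuper.Build F (super_subvs hU) sub_even_idem.

Lemma sub_val_spart r (w : super_subvs hU) : sub_val (spart r w) = spart r (sub_val w).
Proof.
have e : sub_val (even_part w) = even_part (sub_val w) by exact: sub_evenE.
by case: r; rewrite /spart ?linearB /= e.
Qed.

Lemma sub_val_homog r (w : super_subvs hU) : homog r w <-> homog r (sub_val w).
Proof.
rewrite /homog -sub_val_spart; split=> [->//|]; exact: sub_val_inj.
Qed.

End SubSpace.

Section SubModule.
Variables (F : fieldType) (A : superalgebra F) (V : supermodule A) (U : {vspace V}).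
Hypothesis sU : subsupermodule U.

Let hU := proj1 sU.

Definition sub_act (a : A) : 'End(super_subvs hU) :=
  (sub_proj hU \o smod_act V a \o sub_val hU)%VF.

Lemma sub_actE a w : sub_val hU (sub_act a w) = smod_act V a (sub_val hU w).
Proof. by rewrite !comp_lfunE sub_projK //; apply: (proj2 sU); exact: sub_valP. Qed.

Lemma sub_act_linear : linear sub_act.
Proof.
move=> c a b; apply/lfunP=> w; apply: sub_val_inj.
rewrite add_lfunE scale_lfunE linearP /= !sub_actE smod_act_linear.
by rewrite add_lfunE scale_lfunE.
Qed.

Lemma sub_act1 : sub_act 1 = \1%VF.
Proof.
by apply/lfunP=> w; apply: sub_val_inj; rewrite sub_actE smod_act1 !id_lfunE.
Qed.

Lemma sub_actM a b : sub_act (a * b) = (sub_act a \o sub_act b)%VF.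
Proof.
apply/lfunP=> w; apply: sub_val_inj.
by rewrite [in RHS]comp_lfunE !sub_actE smod_actM comp_lfunE.
Qed.

Lemma sub_act_homog p a : homog p a -> hom_parity p (sub_act a).
Proof.
move=> ha q w /sub_val_homog hw; apply/sub_val_homog; rewrite sub_actE.
exact: (smod_act_homog ha).
Qed.

Definition sub_smod : supermodule A :=
  Supermodule sub_act_linear sub_act1 sub_actM sub_act_homog.

End SubModule.

(** Take a nonzero graded submodule of minimal dimension. *)
Lemma exists_simple_sub (F : fieldType) (A : superalgebra F) (V : supermodule A)
    (U : {vspace V}) : subsupermodule U -> U != 0%VS ->
  exists (W : supermodule A) (j : 'Hom(W, V)),
    [/\ simple_smod W, injective j, (forall w, j w \in U) &
        forall a w, j (smod_act W a w) = smod_act V a (j w)].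
Proof.
have [m] := ubnP (\dim U); elim: m U => // m IH U lem sU U0.
have [[U' [sU' U'U U'0 nU]]|nex] := classic (exists U' : {vspace V},
    [/\ subsupermodule U', (U' <= U)%VS, U' != 0%VS & ~~ (U <= U')%VS]).
  have [|//|//|W [j [sW ij jU jact]]] := IH U'.
    rewrite -ltnS (leq_trans _ lem) // ltnS ltn_neqAle dimvS // andbT.
    by apply: contra nU => /eqP e; have /eqP -> : U' == U by rewrite eqEdim U'U e leqnn.
  by exists W, j; split=> // w; apply: (subvP U'U).
pose W := sub_smod sU; pose j : 'Hom(W, V) := sub_val (proj1 sU).
have ij : injective j by exact: sub_val_inj.
have jact a w : j (smod_act W a w) = smod_act V a (j w) by exact: sub_actE.
have jU w : j w \in U by exact: sub_valP.
exists W, j; split=> //; split.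
  have u0 : vpick U \in U by exact: memv_pick.
  apply/eqP => W0; have : sub_proj (proj1 sU) (vpick U) \in (0%VS : {vspace W}).
    by rewrite -W0 memvf.
  rewrite memv0 => /eqP /(congr1 j); rewrite linear0 [j _]sub_projK // => /eqP.
  by rewrite vpick0 (negPf U0).
move=> X [Xe Xa]; have [->|X0] := eqVneq X 0%VS; first by left.
right; apply/vspaceP=> w; rewrite memvf.
have sjX : subsupermodule (j @: X)%VS.
  split=> [_ /memv_imgP[x Xx ->]|a _ /memv_imgP[x Xx ->]]; last first.
    by rewrite -jact memv_img // Xa.
  have -> : even_part (j x) = j (even_part x) by rewrite [RHS]sub_evenE.
  by rewrite memv_img // Xe.
have UjX : (U <= j @: X)%VS.
  apply: NNPP => /negP h; apply: nex; exists (j @: X)%VS; split=> //.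
    by apply/subvP=> _ /memv_imgP[x _ ->].
  apply: contraNneq X0 => jX0; rewrite -subv0; apply/subvP=> x Xx.
  have := memv_img j Xx; rewrite jX0 !memv0 => /eqP e.
  by apply/eqP/ij; rewrite e linear0.
have /memv_imgP[x Xx /ij ->] := subvP UjX _ (jU w).
by rewrite Xx.
Qed.

Section Regular.
Variables (F : fieldType) (A : superalgebra F).

Definition mull_map (x y : A) : A := x * y.

Lemma mull_map_linear x : linear (mull_map x).
Proof. by move=> c y z; rewrite /mull_map mulrDr salgZAr. Qed.

HB.instance Definition _ x :=
  GRing.isLinear.Build F A A _ (mull_map x) (mull_map_linear x).

Definition reg_act (x : A) : 'End(A) := linfun (mull_map x).

Lemma reg_actE x y : reg_act x y = x * y.
Proof. by rewrite lfunE. Qed.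

Lemma reg_act_linear : linear reg_act.
Proof.
move=> c x y; apply/lfunP=> z; rewrite add_lfunE scale_lfunE !reg_actE.
by rewrite mulrDl salgZAl.
Qed.

Lemma reg_act1 : reg_act 1 = \1%VF.
Proof. by apply/lfunP=> z; rewrite reg_actE id_lfunE mul1r. Qed.

Lemma reg_actM x y : reg_act (x * y) = (reg_act x \o reg_act y)%VF.
Proof. by apply/lfunP=> z; rewrite comp_lfunE !reg_actE mulrA. Qed.

Lemma reg_act_homog p x : homog p x -> hom_parity p (reg_act x).
Proof. by move=> hx q y hy; rewrite reg_actE; apply: salgM_homog. Qed.

Definition reg_smod : supermodule A :=
  Supermodule reg_act_linear reg_act1 reg_actM reg_act_homog.

Lemma spart_mulr_even r (a u : A) : homog false u -> spart r (a * u) = (spart r a : A) * u.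
Proof.
move=> hu; elim/salg_homog_ind: a => [a b IHa IHb|s a ha].
  by rewrite mulrDl !linearD /= mulrDl IHa IHb.
have hau := salgM_homog ha hu; rewrite addbF in hau.
have [->|rs] := eqVneq r s; first by rewrite hau ha.
by rewrite (_ : r = ~~ s) ?(homog_other hau) ?(homog_other ha) ?mul0r //;
  case: r s rs {ha hau} => [] [].
Qed.

(** A simple graded left ideal inside [A * u]; there [u] acts as the identity. *)
Lemma exists_simple_idempotent (u : A) : homog false u -> u != 0 ->
  (forall x, u * x = x * u) -> u * u = u ->
  exists (W : supermodule A) (j : 'Hom(W, A)),
    [/\ simple_smod W, injective j, (forall w, j w \in principal u),
        (forall a w, j (smod_act W a w) = a * j w) & smod_act W u = \1%VF].
Proof.
move=> hu u0 cu uu; have [||W [j [sW ij jU jact]]] :=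
    @exists_simple_sub F A reg_smod (principal u).
- split=> [_ /principalP[a ->]|a v hv].
    rewrite [even_part _](spart_mulr_even false a hu).
    by apply/principalP; eexists.
  by rewrite [smod_act _ _ _]reg_actE; apply: principal_stable.
- apply: contraNneq u0 => e; rewrite -memv0 -e; apply/principalP.
  by exists 1; rewrite mul1r.
have jactE a w : j (smod_act W a w) = a * j w by rewrite jact [LHS]reg_actE.
exists W, j; split=> //; apply/lfunP=> w; apply: ij.
rewrite jactE id_lfunE; have /principalP[a ->] := jU w.
by rewrite cu -mulrA uu.
Qed.

End Regular.

(** * Semisimplicity of the special fibre *)

Section SpecialFibre.
Variables (O : idomainType) (k : fieldType) (pr : {rmorphism O -> k}).
Hypotheses (dvr : is_dvr O) (res : is_residue_map pr) (two : 2%N \notin [pchar k]).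
Local Notation K := ({fraction O} : fieldType).
Local Notation iota := (@FracField.tofrac O).
Variables (A : superalgebra O) (t : {scalar A}) (eps : bool).
Local Notation KA := (ext_salg iota A).
Local Notation kA := (ext_salg pr A).
Local Notation tK := (ext_form (f := iota) t).
Local Notation tk := (ext_form (f := pr) t).
Variables (n : nat) (p : 'I_n -> bool) (B Bd : 'I_n -> A).
Hypothesis frob : frobenius_system eps t p B Bd.

Let frobK := frobenius_ext iota frob.
Let frobk := frobenius_ext pr frob.

Lemma two_k : 2%:R != 0 :> k.
Proof. by move: two; rewrite inE /=. Qed.

Lemma two_K : 2%:R != 0 :> K.
Proof.
apply: contra two_k => /eqP e; rewrite -(rmorph_nat pr).
have -> : 2%:R = 0 :> O by apply/eqP; rewrite -tofrac_eq0 rmorph_nat e.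
by rewrite rmorph0.
Qed.

Lemma residue_unit x : pr x != 0 -> x \is a GRing.unit.
Proof.
by apply: contraR => /(proj2 (proj2 res x)) ->.
Qed.

Lemma iota_neq0 x : pr x != 0 -> iota x != 0.
Proof. by apply: contra; rewrite tofrac_eq0 => /eqP ->; rewrite rmorph0. Qed.

(** The Schur element exists over [K]; the entry of [C] at a diagonal matrix unit
shows that it is integral, and [casimir_nonzero] applied to the reduced
representation that its residue is nonzero. *)
Lemma schur_of_semisimple (V : supermodule KA) :
  semisimple_salg kA -> simple_smod V -> split_smod V ->
  exists2 s : O, schur_elt V eps tK (iota s) & pr s != 0.
Proof.
move=> ss sV spl; have [P [q [R [uP hq hR RE]]]] := exists_lattice dvr V.
pose i0 := Ordinal (simple_dim sV).
have hK := smod_mx_rep uP hq.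
have [|s sch] := mx_schur_exists hK frobK i0.
  by move=> H; apply: even_end_scalar.
have CE G := map_mx_casimir (f := iota) B Bd G RE.
have par j l : q j = q l -> forall S : comNzRingType,
    mx_parity q false (delta_mx j l : 'M[S]_(dim V)).
  by move=> jl S; have := @mx_parity_delta S _ q j l; rewrite jl addbb.
have [s0 sE] : exists s0, s = iota s0.
  have := sch _ (par i0 i0 erefl _).
  rewrite -(map_delta_mx iota) CE map_delta_mx mxtrace_delta eqxx mulr1.
  move=> /(congr1 (fun M => (M *m parity_mx _ q eps) i0 i0)).
  rewrite -scalemxAl parity_mxK [RHS]mxE [X in _ * X]mxE eqxx mulr1 mul_mx_parity mxE => <-.
  by exists ((-1) ^+ (eps && q i0) * mx_casimir R B Bd (delta_mx i0 i0) i0 i0);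
    rewrite rmorphM rmorph_sign.
exists s0.
  by apply/(schur_eltP uP hq frobK i0); rewrite -sE.
have COE j l : q j = q l ->
    mx_casimir R B Bd (delta_mx j l) = (s0 * \tr (delta_mx j l)) *: parity_mx O q eps.
  move=> jl; apply: map_tofrac_inj; rewrite -CE map_delta_mx sch; last exact: par.
  by rewrite map_mxZ map_parity_mx sE !mxtrace_delta rmorphM rmorph_nat.
have hk := ext_repP pr hR.
have [j [l [jl]]] := casimir_nonzero hk frobk i0 ss.
apply: contra_notN => /eqP s00.
rewrite -(map_delta_mx pr) (map_mx_casimir B Bd _ (ext_rep_in pr hR)) COE //.
by rewrite map_mxZ rmorphM s00 mul0r scale0r.
Qed.

(** Composing an odd supercommuting endomorphism with the parity matrix gives an
odd matrix commuting with the algebra, which is zero or invertible by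
simplicity, and not invertible by [no_odd_commuting]. *)
Lemma type_M_of_schur (V : supermodule KA) (s : O) : eps = true ->
  simple_smod V -> split_smod V -> schur_elt V eps tK (iota s) -> pr s != 0 ->
  type_M V.
Proof.
move=> e sV spl sch s0; have [P [q [R [uP hq _ _]]]] := exists_lattice dvr V.
pose i0 := Ordinal (simple_dim sV).
have hK := smod_mx_rep uP hq; move/(schur_eltP uP hq frobK i0): sch => sch.
have commE r g : homog_smod_end r g -> forall a v, 
    g (smod_act V a v) = smod_act V (twist r a) (g v).
  case=> _ cg a v; elim/salg_homog_ind: a => [x y IHx IHy|s' x hx].
    have actD (x' y' : KA) w : smod_act V (x' + y') w = smod_act V x' w + smod_act V y' w.
      by rewrite smod_actD add_lfunE.
    by rewrite (twistD _ x y) (actD x y) (actD (twist r x)) linearD /= IHx IHy.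
  rewrite (cg _ _ _ hx) (twist_homog _ hx).
  by rewrite smod_actZ scale_lfunE.
exists <[\1%VF]>%VS; split; last first.
  rewrite dim_vline (_ : (\1%VF : 'End(V)) != 0) //.
  apply/eqP => /(congr1 f2mx); rewrite f2mx1 => /matrixP /(_ i0 i0).
  rewrite f2mx0.
  by rewrite !mxE eqxx => /eqP; rewrite oner_eq0.
move=> g; split=> [/vlineP[c ->]|[g0 [g1 [-> h0 h1]]]].
  exists (c *: \1%VF), 0; split; first by rewrite addr0.
    split=> [r v hv|r a v ha]; rewrite !scale_lfunE !id_lfunE; first exact: homogZ.
    by rewrite scale1r linearZ.
  split=> [r v hv|r a v ha]; rewrite !zero_lfunE; first exact: homog0.
  by rewrite linear0 scaler0.
have [|c ->] := split_even_end sV spl (proj1 h0).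
  by move=> a v; rewrite (commE _ _ h0) /twist scale1r -spartD.
suff -> : g1 = 0 by rewrite addr0; apply/vlineP; exists c.
pose H := end_mx P g1 *m parity_mx _ q true.
have hH : mx_parity q true H.
  exact: (mx_parityM (end_mx_parity uP hq (proj1 h1)) (@mx_parity_diag _ _ q true)).
have cH a : smod_mx P a *m H = H *m smod_mx P a.
  apply: (twist_commuting hK) => {}a; rewrite /smod_mx -(end_mx_comp uP) -(end_mx_comp uP).
  by congr (end_mx P _); apply/lfunP=> v; rewrite !comp_lfunE (commE _ _ h1) twistK.
have [H0|uH] := odd_end_unit uP hq sV hH cH; last first.
  have := no_odd_commuting i0 two_K e (iota_neq0 s0) sch hH cH.
  by rewrite uH.
apply: (can_inj (end_mxK uP)).
by rewrite -[LHS]mulmx1 -(parity_mxK _ q true) mulmxA -/H H0 mul0mx end_mx0.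
Qed.

(** Modulo the maximal ideal, [R a] and [T] commute because [a] is even, so the
residue of [R a *m T] is nilpotent too. *)
Lemma trace_reduction_nilpotent d (q : 'I_d -> bool) (R : A -> 'M[O]_d) a m :
  graded_mx_rep q R -> homog false a -> salg_in pr a ^+ m = 0 ->
  pr (\tr (R a *m parity_mx O q eps)) = 0.
Proof.
move=> hR ha am; have hk := ext_repP pr hR.
pose N := map_mx pr (R a); pose T := parity_mx k q eps.
have NE : N = ext_rep R (salg_in pr a) by rewrite (ext_rep_in pr hR).
have hN : mx_parity q false N.
  by rewrite NE; apply: (rep_homog hk); exact: salg_in_homog.
have cNT : T *m N = N *m T.
  rewrite -[LHS]mulmx1 -(parity_mxK k q eps) mulmxA -/T.
  by rewrite (mx_parity_comm _ hN) andbF scale1r.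
have -> : pr (\tr (R a *m parity_mx O q eps)) = \tr (N *m T).
  by rewrite -trace_map_mx map_mxM map_parity_mx.
apply: (@mxtrace_nilpotent _ _ _ m).
have -> : iter m (mulmx (N *m T)) 1%:M = iter m (mulmx N) 1%:M *m iter m (mulmx T) 1%:M.
  elim: (m) => [|l IH]; first by rewrite mulmx1.
  rewrite !iterS IH !mulmxA; congr (_ *m _); rewrite -!mulmxA; congr (_ *m _).
  elim: (l) => [|l' IHl]; first by rewrite /= mulmx1 mul1mx.
  by rewrite iterS !mulmxA cNT -!mulmxA IHl.
by rewrite NE -(repX hk) am (rep0 hk) mul0mx.
Qed.

(** Induction on the dimension of the left ideal generated by the central even
idempotent [u]. A simple submodule [W] of it yields, by
[central_trace_element], a central idempotent [e = lam^-1 *: z] with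
[u * e = e], and [x |-> t (e * x)] is [lam^-1] times the (super)trace on [W],
where [lam] is a unit of [O]. The idempotent [u - e] kills [W], so it generates
a strictly smaller left ideal. *)
Lemma form_expansion : 
  (forall V : supermodule KA, simple_smod V ->
     exists2 s : O, schur_elt V eps tK (iota s) & pr s != 0) ->
  forall a m, homog false a -> salg_in pr a ^+ m = 0 ->
  forall u : KA, homog false u -> (forall x, u * x = x * u) -> u * u = u ->
  exists y, pr y = 0 /\ tK (u * salg_in iota a) = iota y.
Proof.
move=> sch a m ha am u; have tl := frob_lin frobK.
have [N] := ubnP (\dim (principal u)); elim: N u => // N IH u lem hu cu uu.
have [->|u0] := eqVneq u 0.
  exists 0; rewrite rmorph0 mul0r rmorph0; split=> //.
  by have := scalarZ_of tl 0 0; rewrite scale0r mul0r.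
have [W [j [sW ij jU jact actu]]] := exists_simple_idempotent hu u0 cu uu.
have [P [q [R [uP hq hR RE]]]] := exists_lattice dvr W.
pose i0 := Ordinal (simple_dim sW).
have hK := smod_mx_rep uP hq.
have [s schs s0] := sch W sW; move/(schur_eltP uP hq frobK i0): schs => schs.
have [|z [lam [hz cz tz rz lamE]]] :=
    central_trace_element hK frobK two_K schs (iota_neq0 s0).
  by move=> H; apply: odd_end_unit.
have [l lE l0] : exists2 l, lam = iota l & pr l != 0.
  case: lamE => ->; first by exists s.
  exists (2%:R * s); first by rewrite rmorphM rmorph_nat.
  by rewrite rmorphM rmorph_nat mulf_neq0 // two_k.
have lam0 : lam != 0 by rewrite lE iota_neq0.
have ru : smod_mx P u = 1%:M by rewrite /smod_mx actu end_mx1.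
have uz : u * z = z.
  apply: (frobenius_eq frobK) => b; rewrite -cz -mulrA !tz (repM hK) ru mul1mx //.
have zz : z * z = lam *: z.
  apply: (frobenius_eq frobK) => b.
  rewrite -salgZAl (scalarZ_of tl) -mulrA !tz (repM hK) rz mul_scalar_mx.
  by rewrite -scalemxAl mxtraceZ.
pose e := lam^-1 *: z; pose u' := u - e.
have ue : u * e = e by rewrite /e -salgZAr uz.
have eu : e * u = e by rewrite -cu ue.
have ee : e * e = e by rewrite /e -salgZAl -salgZAr zz !scalerA -mulrA mulVf // mulr1.
have u'u : u' * u = u' by rewrite mulrBl uu eu.
have u'u' : u' * u' = u' by rewrite mulrBr u'u mulrBl ue ee subrr subr0.
have cu' x : u' * x = x * u'.
  by rewrite mulrBl mulrBr cu /e -salgZAl -salgZAr cz.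
have hu' : homog false u' by apply: homogB => //; apply: homogZ.
have [||||y [y0 yE]] := IH u' => //.
  rewrite -ltnS (leq_trans _ lem) // ltnS.
  have sub : (principal u' <= principal u)%VS.
    apply/subvP=> _ /principalP[b ->]; apply/principalP; exists (b * u').
    by rewrite -mulrA u'u.
  rewrite ltn_neqAle dimvS // andbT; apply/negP => /eqP edim.
  have /eqP E : principal u' == principal u by rewrite eqEdim sub edim leqnn.
  have W0 w : w = 0 :> W.
    apply: ij; rewrite linear0; have := jU w; rewrite -E => /principalP[b jwE].
    have : u' * j w = j w by rewrite jwE cu' -mulrA u'u'.
    suff u'0 : smod_act W u' = 0 by rewrite -jact u'0 zero_lfunE linear0.
    apply: (can_inj (end_mxK uP)).
    rewrite end_mx0; have u'E : u' = (-1) *: e + u by rewrite scaleN1r addrC.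
    rewrite -/(smod_mx P u') u'E (rep_linear hK) ru /e (repZ hK) rz.
    by rewrite scale_scalar_mx (mulVf lam0) scaleN1r addNr.
  have [V0 _] := sW; case/negP: V0; rewrite -subv0; apply/subvP=> w _.
  by rewrite (W0 w) mem0v.
exists (y + l^-1 * \tr (R a *m parity_mx O q eps)); split.
  by rewrite rmorphD rmorphM y0 (trace_reduction_nilpotent hR ha am) mulr0 addr0.
have -> : u * salg_in iota a = u' * salg_in iota a + lam^-1 *: (z * salg_in iota a).
  by rewrite salgZAl -mulrDl subrK.
rewrite (scalarD_of tl) (scalarZ_of tl) yE tz RE rmorphD rmorphM; congr (_ + _ * _).
  rewrite lE; apply: (mulIf (iota_neq0 l0)); rewrite mulVf ?iota_neq0 //.
  by rewrite -rmorphM mulVr ?residue_unit // rmorph1.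
by rewrite -(map_parity_mx iota) -map_mxM trace_map_mx.
Qed.

(** By [form_expansion] with [u = 1] the form vanishes on even elements of the
radical, which are nilpotent, hence on the whole radical. *)
Lemma semisimple_of_schur :
  (forall V : supermodule KA, simple_smod V ->
     exists2 s : O, schur_elt V eps tK (iota s) & pr s != 0) ->
  semisimple_salg kA.
Proof.
move=> sch x Jx; have tl := frob_lin frobk.
have tJ (w : kA) : jacobson_radical w -> tk w = 0.
  move=> Jw; rewrite {1}[w]spartD (scalarD_of tl).
  rewrite (frob_even frobk (spart_homog true w)) addr0.
  have [m wm] := jacobson_nilpotent (jacobson_spart two_k Jw).
  have [a aE] := salg_in_surj (proj1 res) (spart false w : kA).
  pose a0 : A := spart false a.
  have a0E : salg_in pr a0 = spart false w.
    by rewrite -[LHS](ext_in_spart pr false a) [ext_in pr a]aE spart_idem.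
  have a0m : salg_in pr a0 ^+ m = 0 by rewrite a0E.
  have [|x0||y [y0]] := form_expansion sch (spart_homog false a) a0m (u := 1).
  - exact: salg_one_homog.
  - by rewrite mulr1 mul1r.
  - by rewrite mulr1.
  rewrite mul1r form_in => /eqP; rewrite tofrac_eq => /eqP tE.
  by rewrite -a0E form_in tE.
(* The radical is stable under the twist and a left ideal, so
   [t (x * z) = t (z * twist eps x) = 0] for all [z]. *)
apply: (frobenius_eq frobk) => z; rewrite mul0r.
have -> : tk 0 = 0 by have := scalarZ_of tl 0 0; rewrite scale0r mul0r.
rewrite (frob_twist frobk); apply: tJ; apply: jacobson_left.
exact: jacobson_twist.
Qed.

End SpecialFibre.

Theorem theorem1p2 (O : idomainType) (k : fieldType) (pr : {rmorphism O -> k})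
    (A : superalgebra O) (t : {scalar A}) :
  let K : fieldType := {fraction O} in
  let KA : superalgebra K := ext_salg (@FracField.tofrac O) A in
  let kA : superalgebra k := ext_salg pr A in
  let tK : KA -> K := ext_form t in
  is_dvr O -> is_residue_map pr -> 2%N \notin [pchar k] ->
  split_salg kA -> split_salg KA ->
  (symmetrizing_form t ->
    (semisimple_salg kA <->
     forall V : supermodule KA, simple_smod V ->
       exists2 s : O, schur_element tK V (FracField.tofrac s) & pr s != 0)) /\
  (supersymmetrizing_form t ->
    (semisimple_salg kA <->
     (forall V : supermodule KA, simple_smod V -> type_M V) /\
     (forall V : supermodule KA, simple_smod V ->
       exists2 s : O, super_schur_element tK V (FracField.tofrac s) & pr s != 0))).
Proof.
move=> K KA kA tK dvr res two _ spl; split=> -[te nd sym].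
  have tw : forall x y : A, t (x * y) = t (y * twist false x).
    by move=> x y; rewrite sym /twist scale1r -spartD.
  have [n [p [B [Bd frob]]]] := frobenius_systemP te nd tw.
  split=> [ss V sV|]; first exact: (schur_of_semisimple dvr frob ss sV (spl V sV)).
  exact: (semisimple_of_schur dvr res two frob).
have tw := frobenius_twist (eps := true) te sym.
have [n [p [B [Bd frob]]]] := frobenius_systemP te nd tw.
have sch (ss : semisimple_salg kA) V sV :=
  schur_of_semisimple dvr frob ss sV (spl V sV).
split=> [ss|[_ h]]; last exact: (semisimple_of_schur dvr res two frob).
split=> [V sV|]; last exact: sch.
have [s schs s0] := sch ss V sV.
exact: (type_M_of_schur dvr two frob erefl sV (spl V sV) schs s0).
Qed.
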